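(* Let $J,\nu\in\mathbb N$ and $a>0$ satisfy $$a\Big(1+\frac1\nu\Big)<1,\qquad 1<\nu<J,\qquad \frac{J}{2J-1}<a<1-\frac{(J+1)(J+\nu)}{\nu J^2+J+\nu}.$$ Consider the switched network with parameters $(a,\nu,J)$ described in the context, operated under the policy that, given the queue length vector $\mathbf Q$, uses a schedule $\boldsymbol\sigma\in\mathcal S$ maximizing both $$Q_{\mathcal A_0}\sigma_{\mathcal A_0}+\frac1\nu\sum_{j=1}^JQ_{\mathcal A_j}\sigma_{\mathcal A_j}\qquad\text{and}\qquad Q_{\mathcal B_0}\sigma_{\mathcal B_0}+\frac1\nu\sum_{j=1}^JQ_{\mathcal B_j}\sigma_{\mathcal B_j}.$$ Then $\boldsymbol\rho\in\mathcal C$ (the interior of the convex hull of $\mathcal S$), and the associated queueing network process $(\mathbf Q(t):t\in\mathbb Z_+)$ is transient. Consequently, the corresponding multiclass Longest-Queue-First-Served (LQFS) queueing network is both subcritical and transient.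
   Context: $\mathbb Z_+=\{0,1,2,\dots\}$, $\mathbb N=\{1,2,\dots\}$. **The network.** There are $2J+2$ queues $\mathcal A_0,\mathcal A_1,\dots,\mathcal A_J,\mathcal B_0,\mathcal B_1,\dots,\mathcal B_J$. Time is discrete. External arrivals occur only at the queues $\mathcal A_j,\mathcal B_j$ with $1\le j\le J$. At each such queue the number of external arrivals per time unit is $0$ or $1$ with mean $a/J$, i.i.d. over time and independent across queues. Every job requires exactly one unit of service at each queue it visits. A job completing service at $\mathcal A_j$ ($1\le j\le J$) moves to $\mathcal B_0$. A job completing service at $\mathcal B_j$ ($1\le j\le J$) moves to $\mathcal A_0$. Jobs completing service at $\mathcal A_0$ or $\mathcal B_0$ leave the network. **Traffic intensity.** $\rho_{\mathcal A_0}=\rho_{\mathcal B_0}=a$ and $\rho_{\mathcal A_j}=\rho_{\mathcal B_j}=a/J$ for $1\le j\le J$. **Schedules.** $\mathcal S$ is the set of vectors $\boldsymbol\sigma$ with coordinates in $\mathbb Z_+$, indexed by the queues, satisfying $$\sigma_{\mathcal A_0}+\frac1\nu\sum_{j=1}^J\sigma_{\mathcal A_j}\le 1\quad\text{and}\quad \sigma_{\mathcal B_0}+\frac1\nu\sum_{j=1}^J\sigma_{\mathcal B_j}\le 1 .$$ **Dynamics.** Let $\boldsymbol\pi(\mathbf Q)\in\mathcal S$ be the schedule chosen at $\mathbf Q$ (ties broken arbitrarily or randomly, depending only on $\mathbf Q$). In time step $t\in\mathbb N$, queue $i$ first serves $\pi_i(\mathbf Q(t-1))\wedge Q_i(t-1)$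 jobs. Then the served jobs move to their next queue or leave, and the external arrivals of step $t$ join their queues, giving $\mathbf Q(t)$. The process is a discrete time countable state space Markov chain. **Corresponding multiclass LQFS queueing network.** It has two stations $\mathcal A$ and $\mathcal B$. The queues $\mathcal A_0,\dots,\mathcal A_J$ are the classes at station $\mathcal A$, and $\mathcal B_0,\dots,\mathcal B_J$ the classes at station $\mathcal B$. External arrivals occur only at the classes $\mathcal A_j,\mathcal B_j$ with $1\le j\le J$, where the number of arrivals per time unit is $0$ or $1$ with mean $a/J$, i.i.d. over time and independent across classes. A job completing service at $\mathcal A_j$ ($1\le j\le J$) moves to $\mathcal B_0$, a job completing service at $\mathcal B_j$ ($1\le j\le J$) moves to $\mathcal A_0$, and jobs completing service at $\mathcal A_0$ or $\mathcal B_0$ leave the network. In each time unit each station selects its longest class (ties broken arbitrarily) and devotes all of its service to it. In one time unit a station can serve a batch of up to $\nu$ jobs if the selected class is $\mathcal A_j$ or $\mathcal B_j$ with $j\ge1$, and one job if the selected class is $\mathcal A_0$ or $\mathcal B_0$. It is called subcritical if the traffic intensity (total arrival rate of work, measured in time needed to serve it) at each station is $<1$. *)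

(* Defs.v *)
From HB Require Import structures.
From mathcomp Require Import all_boot all_order all_algebra.
From mathcomp Require Import all_classical all_reals all_analysis.

Set Implicit Arguments.
Unset Strict Implicit.
Unset Printing Implicit Defensive.

Import Order.TTheory GRing.Theory Num.Theory numFieldNormedType.Exports.

Local Open Scope classical_set_scope.
Local Open Scope ring_scope.

Section MarkovChains.
Variables (R : realType) (S : countType).

(* The product form of the Markov property also covers conditioning events of
   probability zero; the initial law is left free. *)
Definition markov_chain (K : S -> S -> R) d (T : measurableType d)
    (P : probability T R) (X : nat -> T -> S) : Prop :=
  (forall t x, measurable (X t @^-1` [set x])) /\
  (forall n (x : nat -> S),
     P [set w | forall t, (t <= n.+1)%N -> X t w = x t] =
     (P [set w | forall t, (t <= n)%N -> X t w = x t]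
       * (K (x n) (x n.+1))%:E)%E).

(* P_x(X returns to x at some positive time) < 1. This number depends only on
   K and x, hence the quantification over all realizations started from x. *)
Definition transient_state (K : S -> S -> R) (x : S) : Prop :=
  forall (d : measure_display) (T : measurableType d) (P : probability T R)
    (X : nat -> T -> S),
    markov_chain K P X -> P (X 0%N @^-1` [set x]) = 1%E ->
    (P [set w | exists t, X t.+1 w = x] < 1)%E.

Definition transient_chain (K : S -> S -> R) : Prop :=
  forall x, transient_state K x.

End MarkovChains.

Definition convex_hull (R : realType) m n (A : set 'M[R]_(m, n)) :
    set 'M[R]_(m, n) :=
  smallest (fun B : set 'M[R]_(m, n) => convex_set B) A.

Section Network.
Variables (R : realType) (J : nat).

(* Families indexed by the 2J+2 queues are 2 x (J+1) matrices: row 0 is the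
   station A, row 1 the station B, and column j is the queue A_j or B_j.
   For s : 'I_2, [rev_ord s] is the other station. *)

Definition rho (a : R) : 'M[R]_(2, J.+1) :=
  \matrix_(s, j) (if j == ord0 then a else a / J%:R).

Definition station_sum (nu : nat) (x : 'I_J.+1 -> R) : R :=
  x ord0 + nu%:R^-1 * \sum_(j < J.+1 | j != ord0) x j.

Definition schedules (nu : nat) : set 'M[nat]_(2, J.+1) :=
  [set sigma | forall s, station_sum nu (fun j => (sigma s j)%:R) <= 1].

Definition admissible (nu : nat) : set 'M[R]_(2, J.+1) :=
  interior (convex_hull
    ((fun sigma : 'M[nat]_(2, J.+1) => map_mx (fun k : nat => k%:R : R) sigma)
       @` schedules nu)).

Definition weight (nu : nat) (q sigma : 'M[nat]_(2, J.+1)) (s : 'I_2) : R :=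
  station_sum nu (fun j => (q s j)%:R * (sigma s j)%:R).

Definition max_weight (nu : nat) (q sigma : 'M[nat]_(2, J.+1)) : Prop :=
  schedules nu sigma /\
  forall sigma', schedules nu sigma' ->
    forall s, weight nu q sigma' s <= weight nu q sigma s.

Definition served (q sigma : 'M[nat]_(2, J.+1)) : 'M[nat]_(2, J.+1) :=
  \matrix_(s, j) minn (sigma s j) (q s j).

(* One time step from [q], with service offered [sigma] and external arrivals
   [al]: jobs served at A_j (resp. B_j), j >= 1, join B_0 (resp. A_0), jobs
   served at A_0 or B_0 leave. *)
Definition step (q sigma : 'M[nat]_(2, J.+1)) (al : 'M[bool]_(2, J.+1)) :
    'M[nat]_(2, J.+1) :=
  \matrix_(s, j)
    (q s j - served q sigma s j
     + (if j == ord0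
        then \sum_(k < J.+1 | k != ord0) served q sigma (rev_ord s) k else 0)
     + al s j)%N.

Definition arrival_mean (a : R) (j : 'I_J.+1) : R :=
  if j == ord0 then 0 else a / J%:R.

Definition arrival_law (a : R) (al : 'M[bool]_(2, J.+1)) : R :=
  \prod_s \prod_j
    (if al s j then arrival_mean a j else 1 - arrival_mean a j).

Definition step_law (a : R) (q sigma q' : 'M[nat]_(2, J.+1)) : R :=
  \sum_(al : 'M[bool]_(2, J.+1)) arrival_law a al * (step q sigma al == q')%:R.

(* [kappa q] is the law of the schedule used at [q]; a Dirac mass for each [q]
   is a deterministic tie-breaking rule. *)
Definition max_weight_policy (nu : nat)
    (kappa : 'M[nat]_(2, J.+1) -> 'M[nat]_(2, J.+1) -> R) : Prop :=
  forall q,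
    [/\ forall sigma, 0 <= kappa q sigma,
        forall sigma, kappa q sigma != 0 -> max_weight nu q sigma
      & \sum_(sigma \in schedules nu) kappa q sigma = 1].

Definition switched_kernel (nu : nat) (a : R)
    (kappa : 'M[nat]_(2, J.+1) -> 'M[nat]_(2, J.+1) -> R)
    (q q' : 'M[nat]_(2, J.+1)) : R :=
  \sum_(sigma \in schedules nu) kappa q sigma * step_law a q sigma q'.

(* [c s] is the class selected at the station s; [kappa q] is the law of the
   pair of selections made at [q]. *)
Definition longest_queue_policy
    (kappa : 'M[nat]_(2, J.+1) -> {ffun 'I_2 -> 'I_J.+1} -> R) : Prop :=
  forall q,
    [/\ forall c, 0 <= kappa q c,
        forall c, kappa q c != 0 -> forall s j, (q s j <= q s (c s))%N
      & \sum_(c : {ffun 'I_2 -> 'I_J.+1}) kappa q c = 1].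

Definition batch (nu : nat) (c : {ffun 'I_2 -> 'I_J.+1}) :
    'M[nat]_(2, J.+1) :=
  \matrix_(s, j) (if j == c s then if j == ord0 then 1%N else nu else 0%N).

Definition lqfs_kernel (nu : nat) (a : R)
    (kappa : 'M[nat]_(2, J.+1) -> {ffun 'I_2 -> 'I_J.+1} -> R)
    (q q' : 'M[nat]_(2, J.+1)) : R :=
  \sum_(c : {ffun 'I_2 -> 'I_J.+1})
     kappa q c * step_law a q (batch nu c) q'.

(* A job takes time 1 in the class A_0 or B_0 and 1/nu in any other class, so
   the weights in [station_sum] are the service times. *)
Definition subcritical (nu : nat) (a : R) : Prop :=
  forall s : 'I_2, station_sum nu (fun j => rho a s j) < 1.

End Network.

(* Main.v *)
(* Transience: a nonnegative superharmonic function that takes smaller values at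
   points reachable from each state rules out recurrence. It is built as follows.
   For a station s let x and y be its outer queue and the sum of its inner queues,
   and X, Y those of the other station; put g = nu * J / (J + nu). The network
   alternates between draining, where s empties its long outer queue and its inner
   queues fill up, and refilling, where the inner queues of one station are emptied
   into the outer queue of the other one, which becomes longer than the first.
   - charge = a * (x + Y) + b * y, with b slightly above 1 - a, has drift
     a * (a + b - 1) > 0 as long as s serves its outer queue.
   - lead = x + g / J * Y - g * (X + y) has drift at least g - 1 - a * g > 0 as long
     as the other station is busy, whatever s serves (upper bound on a).
   - gap = x - g * y increases while the other station serves inner queues, and
     s serves its outer queue when gap is large.
   - feed = X + Y / nu is the work at the other station: it decreases as long as
     that station is busy and s serves its outer queue.
   The weights exp (- charge) * (1 + exp (- lead) + exp (- gap)) (draining) and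
   exp (- charge) * (1 + exp feed) (refilling), suitably scaled and shifted and
   multiplied by a penalty for unequal inner queues, are each superharmonic where
   they are the smallest, so the minimum of the four of them, capped by a constant,
   is superharmonic everywhere. Since (a - b) * J > a (lower bound on a), a small
   refilling weight forces s to serve its outer queue. *)
Require Import Defs.
From HB Require Import structures.
From mathcomp Require Import all_boot all_order all_algebra.
From mathcomp Require Import all_classical all_reals all_analysis.
From mathcomp Require Import ring lra zify.
Set Implicit Arguments.
Unset Strict Implicit.
Unset Printing Implicit Defensive.
Import Order.TTheory GRing.Theory Num.Theory numFieldNormedType.Exports.
Local Open Scope classical_set_scope.
Local Open Scope ring_scope.

(** * Transience of a finite-range Markov kernel from a superharmonic function *)

Lemma set_seq_cons (T : eqType) (z : T) (r : seq T) :
  [set` z :: r] = [set z] `|` [set` r].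
Proof.
apply/seteqP; split=> t /=; rewrite inE; first by case/orP=> [/eqP|]; [left|right].
by case=> [->|->]; rewrite ?eqxx ?orbT.
Qed.

Section TransienceCriterion.
Variables (R : realType) (S : countType) (K : S -> S -> R) (Z : S -> seq S).
Hypothesis Z_uniq : forall y, uniq (Z y).
Hypothesis K_ge0 : forall y z, 0 <= K y z.
Hypothesis K_supp : forall y z, z \notin Z y -> K y z = 0.
Hypothesis K_sum : forall y, \sum_(z <- Z y) K y z = 1.

Definition kernel_mean (f : S -> R) (y : S) : R := \sum_(z <- Z y) K y z * f z.

(** Entering [x] pays 1 and stops the chain, so a nonnegative [f] with [stopped_mean x f <= f]
    bounds the probability of hitting [x] at a positive time. *)
Definition stopped_mean (x : S) (f : S -> R) : S -> R :=
  kernel_mean (fun z => if z == x then 1 else f z).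

Lemma kernel_mean_le (f g : S -> R) y :
  (forall z, f z <= g z) -> kernel_mean f y <= kernel_mean g y.
Proof. by move=> fg; apply: ler_sum => z _; rewrite ler_wpM2l. Qed.

Lemma kernel_mean_cst r y : kernel_mean (fun=> r) y = r.
Proof. by rewrite /kernel_mean -mulr_suml K_sum mul1r. Qed.

Lemma kernel_mean_lt1 (f : S -> R) y z :
  0 < K y z -> (forall t, f t <= 1) -> f z < 1 -> kernel_mean f y < 1.
Proof.
move=> Kyz f1 fz; rewrite -[ltRHS](kernel_mean_cst 1 y) /kernel_mean.
have zZ : z \in Z y by apply: contraLR Kyz => /K_supp ->; rewrite ltxx.
rewrite !(big_rem z zZ) /= ltr_leD ?ltr_pM2l //.
by apply: ler_sum => t _; rewrite ler_wpM2l.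
Qed.

Section Hitting.
Context d (T : measurableType d) (P : probability T R) (X : nat -> T -> S).
Hypothesis XK : markov_chain K P X.

Let X_measurable t x : measurable (X t @^-1` [set x]). Proof. exact: XK.1. Qed.

Let cylinder n (y : nat -> S) : set T :=
  [set w | forall t, (t <= n)%N -> X t w = y t].

Let hit (x : S) n k : set T :=
  [set w | exists2 t, (n < t <= n + k)%N & X t w = x].

Let measurable_cylinder n y : measurable (cylinder n y).
Proof.
have -> : cylinder n y = \bigcap_(t in [set t | (t <= n)%N]) X t @^-1` [set y t].
  by [].
exact: bigcap_measurableType.
Qed.

Let measurable_hit x n k : measurable (hit x n k).
Proof.
have -> : hit x n k = \bigcup_(t in [set t | (n < t <= n + k)%N]) X t @^-1` [set x].
  by [].
exact: bigcup_measurable.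
Qed.

Let next (y : nat -> S) n (z : S) : nat -> S :=
  fun t => if (t <= n)%N then y t else z.

Let cylinder_next n y z :
  cylinder n.+1 (next y n z) = cylinder n y `&` X n.+1 @^-1` [set z].
Proof.
rewrite /cylinder /next; apply/seteqP; split=> [w Xw|w [Xw Xz] t] /=.
  split=> [t tn|]; first by have := Xw t (leqW tn); rewrite tn.
  by have := Xw _ (leqnn _); rewrite ltnn.
rewrite leq_eqVlt ltnS => /orP[/eqP ->|tn]; first by rewrite ltnn.
by rewrite tn; exact: Xw.
Qed.

Let prob_cylinder_next n y z :
  P (cylinder n y `&` X n.+1 @^-1` [set z]) = (P (cylinder n y) * (K (y n) z)%:E)%E.
Proof.
rewrite -cylinder_next /cylinder XK.2 /next leqnn ltnn.
congr (P _ * _)%E; apply/seteqP; split=> w /= Xw t tn; have := Xw t tn;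
  by rewrite tn.
Qed.

Let pr A := fine (P A).

Let prE A : measurable A -> P A = (pr A)%:E.
Proof. by move=> mA; rewrite fineK// fin_num_measure. Qed.

Let pr_le A B : measurable A -> measurable B -> A `<=` B -> pr A <= pr B.
Proof.
move=> mA mB AB; rewrite -lee_fin -!prE//; apply: le_measure => //;
  by rewrite inE.
Qed.

Let measurable_mem n (r : seq S) : measurable (X n @^-1` [set` r]).
Proof.
elim: r => [|z r IH]; first by rewrite set_nil preimage_set0.
by rewrite set_seq_cons preimage_setU; exact: measurableU.
Qed.

Let pr_split (A : set T) n (r : seq S) : measurable A ->
  pr A <= \sum_(z <- r) pr (A `&` X n @^-1` [set z])
          + pr (A `\` X n @^-1` [set` r]).
Proof.
move=> mA; have mX z : measurable (X n @^-1` [set z]) by exact: X_measurable.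
elim: r => [|z r IH].
  by rewrite big_nil add0r set_nil preimage_set0 setD0.
rewrite big_cons -addrA; apply: le_trans IH _.
rewrite addrCA lerD2l set_seq_cons preimage_setU.
set U := X n @^-1` [set` r].
have mU : measurable U by exact: measurable_mem.
have mAz := measurableI _ _ mA (mX z).
have mAV := measurableD mA (measurableU _ _ (mX z) mU).
rewrite -lee_fin EFinD -!prE//; last exact: measurableD.
apply: le_trans (measureU2 _ mAz mAV).
apply: le_measure; rewrite ?inE//; [exact: measurableD|exact: measurableU|].
move=> w [Aw Uw]; have [Xz|Xz] := pselect (X n w = z); [by left|right].
by split=> // -[].
Qed.

(** Removing the states of [Z (y n)] one at a time leaves, relative to the cylinder, one minus a
    partial sum of the kernel; by [K_sum] nothing is left at the end. *)
Let pr_cylinder_off n y :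
  pr (cylinder n y `\` X n.+1 @^-1` [set` Z (y n)]) = 0.
Proof.
have mX z : measurable (X n.+1 @^-1` [set z]) by exact: X_measurable.
have mC : measurable (cylinder n y) by exact: measurable_cylinder.
have sumE (r : seq S) : uniq r ->
    pr (cylinder n y `\` X n.+1 @^-1` [set` r])
    = pr (cylinder n y) * (1 - \sum_(z <- r) K (y n) z).
  elim: r => [_|z r IH /= /andP[zr /IH{}IH]].
    by rewrite big_nil subr0 mulr1 set_nil preimage_set0 setD0.
  rewrite big_cons set_seq_cons preimage_setU; set V := X n.+1 @^-1` [set` r].
  have mV : measurable V by exact: measurable_mem.
  have -> : cylinder n y `\` (X n.+1 @^-1` [set z] `|` V)
      = (cylinder n y `\` V) `\` (cylinder n y `&` X n.+1 @^-1` [set z]).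
    apply/seteqP; split=> w.
      move=> [Cw Uw]; split; first by split=> // Vw; apply: Uw; right.
      by move=> [_ Xz]; apply: Uw; left.
    by move=> [[Cw Vw] Xw]; split=> // -[Xz|//]; apply: Xw.
  have mD : measurable (cylinder n y `\` V) by exact: measurableD.
  have mI := measurableI _ _ mC (mX z).
  have sub : cylinder n y `&` X n.+1 @^-1` [set z] `<=` cylinder n y `\` V.
    by move=> w [Cw /= Xz]; split=> // Vw; move: zr; rewrite -Xz => /negP.
  have : P ((cylinder n y `\` V) `\` (cylinder n y `&` X n.+1 @^-1` [set z]))
      = (P (cylinder n y `\` V) - P (cylinder n y `&` X n.+1 @^-1` [set z]))%E.
    rewrite measureD //; first by rewrite setIidr.
    by rewrite ltey_eq fin_num_measure.
  have mDI := measurableD mD mI.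
  rewrite !prE // -EFinB => -[->]; rewrite IH.
  have := prob_cylinder_next n y z; rewrite !prE // -EFinM => -[->].
  ring.
by rewrite sumE // K_sum subrr mulr0.
Qed.

(** Induction on the horizon [k], conditioning on the next state [z]: if [z] is [x] the payoff 1 is
    a trivial bound, otherwise the induction hypothesis applies to the cylinder extended by [z].
    Next states outside [Z (y n)] carry no mass. *)
Let pr_hit_le (x : S) (f : S -> R) : (forall y, 0 <= f y) ->
    (forall y, stopped_mean x f y <= f y) ->
  forall k n y, pr (cylinder n y `&` hit x n k) <= pr (cylinder n y) * f (y n).
Proof.
move=> f0 fT; have pr0 A : 0 <= pr A by apply: fine_ge0; exact: measure_ge0.
elim=> [|k IH] n y.
  have -> : hit x n 0 = set0.
    by apply/seteqP; split=> // w [t]; rewrite addn0; case: ltnP => //= ? /ltnW;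
      rewrite leqNgt => /negP.
  by rewrite setI0 {1}/pr measure0 /= mulr_ge0.
have mC : measurable (cylinder n y) by exact: measurable_cylinder.
have mH : measurable (hit x n k.+1) by exact: measurable_hit.
have mX z : measurable (X n.+1 @^-1` [set z]) by exact: X_measurable.
have mI := measurableI _ _ mC mH.
apply: le_trans (pr_split n.+1 (Z (y n)) mI) _.
rewrite [X in _ + X](_ : _ = 0) ?addr0; last first.
  apply/eqP; rewrite eq_le pr0 andbT -(pr_cylinder_off n y).
  apply: pr_le; rewrite ?inE.
  - by apply: measurableD => //; exact: measurable_mem.
  - by apply: measurableD => //; exact: measurable_mem.
  - by move=> w [[Cw _] Uw]; split.
apply: le_trans (ler_wpM2l (pr0 _) (fT (y n))).
rewrite /stopped_mean /kernel_mean mulr_sumr; apply: ler_sum => z _.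
have mCz := measurableI _ _ mC (mX z).
have KE : pr (cylinder n y `&` X n.+1 @^-1` [set z]) = pr (cylinder n y) * K (y n) z.
  by have := prob_cylinder_next n y z; rewrite !prE // -EFinM => -[].
rewrite mulrA -KE; case: ifPn => [/eqP _|zx].
  rewrite mulr1; apply: pr_le => //; first exact: measurableI.
  by move=> w [[Cw _] Xz]; split.
have := IH n.+1 (next y n z); rewrite cylinder_next {1}/next ltnn.
apply: le_trans; apply: pr_le.
- exact: measurableI.
- by apply: measurableI; [exact: measurableI|exact: measurable_hit].
(* The hit cannot occur at time [n.+1], where the state is [z], so it falls in the window starting
   after [n.+1]. *)
- move=> w [[Cw [t /andP[nt tnk] Xt]] Xz]; split=> //; exists t => //.
  rewrite ltn_neqAle nt (addSnnS n k) tnk !andbT.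
  by apply: contra_neq zx => tE; rewrite -Xt -tE.
Qed.

(** The bound [f x] on hitting within [k] steps is uniform in [k], and these events increase to the
    return event. *)
Lemma return_prob_lt1 (x : S) (f : S -> R) : (forall y, 0 <= f y) ->
    (forall y, stopped_mean x f y <= f y) -> f x < 1 ->
  P (X 0%N @^-1` [set x]) = 1%E -> (P [set w | exists t, X t.+1 w = x] < 1)%E.
Proof.
move=> f0 fT fx P0.
have -> : [set w | exists t, X t.+1 w = x] = \bigcup_k hit x 0 k.
  apply/seteqP; split=> w /=.
    by move=> [t Xt]; exists t.+1 => //; exists t.+1 => //; rewrite /= add0n leqnn.
  by move=> [k _ [[//|t] _ Xt]]; exists t.
have mH k : measurable (hit x 0 k) by exact: measurable_hit.
have cvgH : P (hit x 0 k) @[k --> \oo] --> P (\bigcup_k hit x 0 k).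
  apply: nondecreasing_cvg_mu => //; first exact: bigcupT_measurable.
  move=> k l kl; apply/subsetPset => w [t /andP[t0 tk] Xt]; exists t => //.
  by rewrite t0 (leq_trans tk) // leq_add2l.
have boundH k : (P (hit x 0 k) <= (f x)%:E)%E.
  have mC : measurable (cylinder 0 (fun=> x)) by exact: measurable_cylinder.
  have C0 : cylinder 0 (fun=> x) = X 0%N @^-1` [set x].
    apply/seteqP; split=> w /=; first by apply.
    by move=> Xw t; rewrite leqn0 => /eqP ->.
  have C1 : pr (cylinder 0 (fun=> x)) = 1 by rewrite /pr C0 P0.
  have mCH := measurableI _ _ mC (mH k).
  (* The chain starts at [x] almost surely, so restricting to the cylinder loses no probability. *)
  have H0 : P (hit x 0 k `\` cylinder 0 (fun=> x)) = 0%E.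
    apply/eqP; rewrite eq_le measure_ge0 andbT.
    apply: (@le_trans _ _ (P (~` cylinder 0 (fun=> x)))).
      apply: le_measure; rewrite ?inE.
      - exact: measurableD.
      - exact: measurableC.
      - by move=> w [].
    by rewrite probability_setC// C0 P0 subee.
  have mHC := measurableI _ _ (mH k) mC; have mHD := measurableD (mH k) mC.
  have : (P (hit x 0 k) <= P (hit x 0 k `&` cylinder 0 (fun=> x))
                           + P (hit x 0 k `\` cylinder 0 (fun=> x)))%E.
    by rewrite -[leLHS](congr1 P (setUIDK _ (cylinder 0 (fun=> x)))) measureU2.
  rewrite H0 adde0 setIC; move/le_trans; apply.
  rewrite prE ?lee_fin; last exact: measurableI.
  by apply: le_trans (pr_hit_le f0 fT k 0 (fun=> x)) _; rewrite C1 mul1r.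
rewrite (le_lt_trans _ (_ : ((f x)%:E < 1)%E)) ?lte_fin //.
rewrite -(cvg_lim _ cvgH) //; apply: lime_le; first by apply/cvg_ex; eexists; exact: cvgH.
by near=> k; exact: boundH.
Unshelve. all: by end_near. Qed.

End Hitting.

(** The function [u], the minimum of 1 and [h / h x], equals 1 at [x] and is superharmonic, hence so
    are all iterates of [stopped_mean x] on it, in the stopped sense. Strict inequality [u < 1] at
    the end of the path travels back one step per iteration and makes some iterate less than 1 at
    [x]. *)
Lemma transient_criterion (h : S -> R) : (forall y, 0 <= h y) ->
    (forall y, kernel_mean h y <= h y) ->
    (forall x, exists2 p, path (fun y z => 0 < K y z) x p & h (last x p) < h x) ->
  transient_chain K.
Proof.
move=> h0 hK hpath x d T P X XK; have [p0 xp0 hp0] := hpath x.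
have hx : 0 < h x by exact: le_lt_trans hp0.
pose u y := Num.min 1 (h y / h x).
have uK y : kernel_mean u y <= u y.
  rewrite le_min; apply/andP; split.
    by rewrite -[leRHS](kernel_mean_cst 1 y); apply: kernel_mean_le => z; rewrite ge_min lexx.
  rewrite ler_pdivlMr // (le_trans _ (hK y)) // /kernel_mean mulr_suml ler_sum // => z _.
  rewrite -mulrA ler_wpM2l // -ler_pdivlMr //.
  by rewrite ge_min lexx orbT.
have ux : u x = 1 by rewrite /u divff ?minxx // gt_eqF.
have u1 y : u y <= 1 by rewrite ge_min lexx.
have u0 y : 0 <= u y by rewrite le_min ler01 divr_ge0 // ltW.
pose f k := iter k (stopped_mean x) u.
have stopped_le (f1 f2 : S -> R) : (forall y, f1 y <= f2 y) ->
    forall y, stopped_mean x f1 y <= stopped_mean x f2 y.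
  by move=> f12 y; apply: kernel_mean_le => z; case: ifP.
have fT k y : stopped_mean x (f k) y <= f k y.
  elim: k y => [|k IH] y; last exact: stopped_le.
  apply: le_trans (uK y); apply: kernel_mean_le => z /=.
  by case: eqP => [->|//]; rewrite ux.
have f0 k y : 0 <= f k y.
  elim: k y => [|k IH] y //=; rewrite -[leLHS](kernel_mean_cst 0 y).
  by apply: kernel_mean_le => z; case: ifP.
have f1 k y : f k y <= 1.
  elim: k y => [|k IH] y //=; rewrite -[leRHS](kernel_mean_cst 1 y).
  by apply: kernel_mean_le => z; case: ifP.
have fpath p y : path (fun y z => 0 < K y z) y p -> u (last y p) < 1 ->
    (exists k, f k y < 1) \/ (exists k, f k x < 1).
  elim: p y => [|z p IH] y /=; first by move=> _ uy; left; exists 0%N.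
  move=> /andP[Kyz /IH{}IH] /IH[[k fz]|]; last by right.
  (* [stopped_mean] replaces the value at [x] by 1, so strictness cannot pass through [x]; but if
     the path returns to [x], the iterate is already less than 1 there. *)
  have [zx|zx] := eqVneq z x; first by right; exists k; rewrite -zx.
  left; exists k.+1; apply: (@kernel_mean_lt1 _ y z) => //.
    by move=> t; case: ifP.
  by rewrite (negPf zx).
have [k fx] : exists k, f k x < 1.
  have : u (last x p0) < 1 by rewrite gt_min ltr_pdivrMr // mul1r hp0 orbT.
  by move=> /(fpath _ _ xp0)[].
exact: (return_prob_lt1 (P := P) XK (f := f k) (f0 k) (fT k) fx).
Qed.

End TransienceCriterion.

(** * Averages over the external arrivals of one time step *)

Section Arrivals.
Variables (R : realType) (J : nat) (a : R).
Implicit Types (s : 'I_2) (j k : 'I_J.+1) (al : 'M[bool]_(2, J.+1)).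

Definition arrival_avg (f : 'M[bool]_(2, J.+1) -> R) : R :=
  \sum_al arrival_law a al * f al.

(** Independence of the arrivals: a sum over all Boolean matrices of a product over entries
    factorizes, by distributivity. *)
Lemma sum_prod_matrix (F : 'I_2 -> 'I_J.+1 -> bool -> R) :
  \sum_(al : 'M[bool]_(2, J.+1)) \prod_s \prod_j F s j (al s j)
  = \prod_s \prod_j (F s j true + F s j false).
Proof.
rewrite [RHS]pair_bigA /=.
transitivity (\prod_(p : 'I_2 * 'I_J.+1) \sum_(b : bool) F p.1 p.2 b); last first.
  by apply: eq_bigr => p _; rewrite big_bool.
rewrite bigA_distr_bigA /=.
rewrite (reindex (fun f : {ffun 'I_2 * 'I_J.+1 -> bool} => \matrix_(s, j) f (s, j))) /=.
  apply: eq_bigr => f _; rewrite pair_bigA /=; apply: eq_bigr => -[s j] _.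
  by rewrite mxE.
exists (fun al : 'M[bool]_(2, J.+1) => [ffun p => al p.1 p.2]) => [f|al] _.
  by apply/ffunP => -[s j]; rewrite ffunE mxE.
by apply/matrixP => s j; rewrite mxE ffunE.
Qed.

Lemma arrival_avg_cst r : arrival_avg (fun=> r) = r.
Proof.
rewrite /arrival_avg -mulr_suml /arrival_law.
rewrite (sum_prod_matrix (fun s j b => if b then arrival_mean a j
                                       else 1 - arrival_mean a j)).
rewrite big1 ?mul1r // => s _; rewrite big1 // => j _; ring.
Qed.

Lemma arrival_avgD f g :
  arrival_avg (fun al => f al + g al) = arrival_avg f + arrival_avg g.
Proof. by rewrite -big_split; apply: eq_bigr => al _; rewrite mulrDr. Qed.

Lemma arrival_avgM r f : arrival_avg (fun al => r * f al) = r * arrival_avg f.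
Proof. by rewrite mulr_sumr; apply: eq_bigr => al _; rewrite mulrCA. Qed.

Lemma arrival_avg_sum (I : Type) (r : seq I) (Q : pred I) f :
  arrival_avg (fun al => \sum_(i <- r | Q i) f i al)
  = \sum_(i <- r | Q i) arrival_avg (f i).
Proof.
rewrite /arrival_avg exchange_big /=; apply: eq_bigr => al _.
by rewrite mulr_sumr.
Qed.

Lemma arrival_avg_entry s j :
  arrival_avg (fun al => (al s j)%:R) = arrival_mean a j.
Proof.
(* The indicator is absorbed into the factor at [(s, j)]; every other factor still sums to 1. *)
pose F t k (b : bool) : R := (if b then arrival_mean a k else 1 - arrival_mean a k)
  * (if (t, k) == (s, j) then b%:R else 1).
have -> : arrival_avg (fun al => (al s j)%:R)
    = \sum_(al : 'M[bool]_(2, J.+1)) \prod_t \prod_k F t k (al t k).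
  apply: eq_bigr => al _; rewrite /arrival_law !pair_bigA /= big_split /=.
  congr (_ * _); rewrite (bigD1 (s, j)) //= eqxx big1 ?mulr1 // => -[t k] /negPf.
  by move=> /= ->.
rewrite sum_prod_matrix pair_bigA /= (bigD1 (s, j)) //= big1 ?mulr1 => [|[t k] /negPf].
  by rewrite /F eqxx /=; ring.
by rewrite /F /= => ->; ring.
Qed.

Hypotheses (J_gt0 : (0 < J)%N) (a_gt0 : 0 < a) (a_lt1 : a < 1).

Lemma arrival_rate_bounds : 0 < a / J%:R < 1.
Proof.
have J0 : 0 < J%:R :> R by rewrite ltr0n.
rewrite divr_gt0 //= ltr_pdivrMr // mul1r (lt_le_trans a_lt1) //.
by rewrite ler1n.
Qed.

Lemma arrival_law_ge0 al : 0 <= arrival_law a al.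
Proof.
have /andP[p0 p1] := arrival_rate_bounds.
apply: prodr_ge0 => s _; apply: prodr_ge0 => j _; rewrite /arrival_mean.
by case: ifP => _; case: ifP => _; lra.
Qed.

Lemma arrival_law_gt0 al : (forall s, al s ord0 = false) -> 0 < arrival_law a al.
Proof.
have /andP[p0 p1] := arrival_rate_bounds.
move=> al0; apply: prodr_gt0 => s _; apply: prodr_gt0 => j _; rewrite /arrival_mean.
have [->|_] := eqVneq j ord0; first by rewrite al0 subr0.
by case: (al s j); lra.
Qed.

Lemma arrival_avg_le f g :
  (forall al, f al <= g al) -> arrival_avg f <= arrival_avg g.
Proof.
by move=> fg; apply: ler_sum => al _; rewrite ler_wpM2l ?arrival_law_ge0.
Qed.

End Arrivals.

(** From [1 - x <= expR (- x)] one gets [expR x <= 1 / (1 - x)], and the quadratic polynomial times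
    [1 - x] is [1 + x ^+ 2 * (1 - 2 * x)]. *)
Lemma expR_le_quad (R : realType) (x : R) : x <= 2^-1 ->
  expR x <= 1 + x + 2 * x ^+ 2.
Proof.
move=> x2; have y0 : 0 < 1 - x by lra.
have : expR x * (1 - x) <= 1.
  rewrite -[leRHS](expRxMexpNx_1 x) ler_wpM2l ?expR_ge0 //.
  by have := expR_ge1Dx (- x).
rewrite -ler_pdivlMr // mul1r => /le_trans; apply.
rewrite -[leLHS]mul1r ler_pdivrMr //.
have -> : (1 + x + 2 * x ^+ 2) * (1 - x) = 1 + x ^+ 2 * (1 - 2 * x) by ring.
by rewrite lerDl mulr_ge0 ?sqr_ge0 //; lra.
Qed.

(** * One-step estimates for linear forms of the queue lengths and their exponentials *)

Section Network.
Variables (R : realType) (J nu : nat) (a : R).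
Implicit Types (s : 'I_2) (j k : 'I_J.+1) (q sigma : 'M[nat]_(2, J.+1)).

Lemma sum_inner_cst (r : R) : \sum_(k < J.+1 | k != ord0) r = J%:R * r.
Proof. by rewrite sumr_const cardC1 card_ord mulr_natl. Qed.

Definition inner (q : 'M[nat]_(2, J.+1)) (s : 'I_2) : R :=
  \sum_(j | j != ord0) (q s j)%:R.

Definition outer (q : 'M[nat]_(2, J.+1)) (s : 'I_2) : R := (q s ord0)%:R.

(** What the drift estimates use of either policy, expressed through the jobs actually served:
    capacity in units of [1 / nu], service of longest queues only, and full use of the capacity once
    some queue holds [nu] jobs. *)
Definition longest_service (q sigma : 'M[nat]_(2, J.+1)) : Prop :=
  let m := served q sigma in
  forall s,
    [/\ (nu * m s ord0 + \sum_(j | j != ord0) m s j <= nu)%N,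
        forall j k, (0 < m s j)%N -> (q s k <= q s j)%N
      & forall k, (nu <= q s k)%N ->
          (nu * m s ord0 + \sum_(j | j != ord0) m s j)%N = nu].

(** The single-queue coefficient [la] is there for the penalty on unequal inner queues, which
    involves one inner queue at a time. *)
Definition linear_form s j (al be la ga de : R) (q : 'M[nat]_(2, J.+1)) : R :=
  al * outer q s + be * inner q s + la * (q s j)%:R
  + ga * outer q (rev_ord s) + de * inner q (rev_ord s).

Definition linear_drift s j (al be la ga de : R) (m : 'M[nat]_(2, J.+1)) : R :=
  al * (inner m (rev_ord s) - outer m s) + be * (a - inner m s)
  + la * (a / J%:R - (m s j)%:R)
  + ga * (inner m s - outer m (rev_ord s)) + de * (a - inner m (rev_ord s)).

Section Step.
Variables (q sigma : 'M[nat]_(2, J.+1)).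
Let m := served q sigma.

Lemma served_le s j : (m s j <= q s j)%N.
Proof. by rewrite mxE geq_minr. Qed.

Lemma outer_step al s :
  outer (step q sigma al) s = outer q s - outer m s + inner m (rev_ord s) + (al s ord0)%:R.
Proof.
rewrite /outer /inner /step mxE eqxx !natrD natrB ?served_le // natr_sum.
by congr (_ + _).
Qed.

Lemma entry_step al s j : j != ord0 ->
  (step q sigma al s j)%:R = (q s j)%:R - (m s j)%:R + (al s j)%:R :> R.
Proof.
by move=> /negPf j0; rewrite /step mxE j0 addn0 !natrD natrB ?served_le.
Qed.

Lemma inner_step al s :
  inner (step q sigma al) s
  = inner q s - inner m s + \sum_(j | j != ord0) (al s j)%:R.
Proof.
rewrite /inner -sumrB -big_split /=; apply: eq_bigr => j j0.
exact: entry_step.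
Qed.

Hypotheses (nu_gt0 : (0 < nu)%N) (mq : longest_service q sigma).

Lemma outer_served s : m s ord0 = 0%N \/
  m s ord0 = 1%N /\ forall j, j != ord0 -> m s j = 0%N.
Proof.
have [ms _ _] := mq s; case E : (m s ord0) => [|[|n]]; first by left.
  right; split=> // j j0; move: ms; rewrite -/m E muln1.
  rewrite -{2}[nu]addn0 leq_add2l leqn0 sum_nat_eq0 => /forallP/(_ j).
  by rewrite j0 => /eqP.
move: ms; rewrite -/m E => /(leq_trans (leq_addr _ _)).
by rewrite -{2}[nu]muln1 leq_pmul2l.
Qed.

Lemma inner_served_le s : inner m s <= nu%:R.
Proof.
have [ms _ _] := mq s; rewrite /inner -natr_sum ler_nat.
exact: leq_trans (leq_addl _ _) ms.
Qed.

Lemma inner_ge0 (p : 'M[nat]_(2, J.+1)) s : 0 <= inner p s.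
Proof. by apply: sumr_ge0 => j _; rewrite ler0n. Qed.

Lemma outer_ge0 (p : 'M[nat]_(2, J.+1)) s : 0 <= outer p s.
Proof. by rewrite /outer ler0n. Qed.

Lemma entry_le_inner (p : 'M[nat]_(2, J.+1)) s j : j != ord0 ->
  (p s j)%:R <= inner p s.
Proof.
by move=> j0; rewrite /inner (bigD1 j) //= lerDl; apply: sumr_ge0 => k _; rewrite ler0n.
Qed.

Lemma outer_served_le1 s : outer m s <= 1.
Proof. by rewrite /outer; case: (outer_served s) => [->|[-> _]]; rewrite ?ler01. Qed.

(** Bounds the one-step change of each coordinate: at most [nu] jobs leave the inner queues of a
    station, at most [J] arrive, and at most one leaves its outer queue. *)
Let N : R := nu%:R + J%:R + 1.

Lemma linear_step_bound s j al be la ga de arr : j != ord0 ->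
  `|linear_form s j al be la ga de (step q sigma arr) - linear_form s j al be la ga de q|
  <= (`|al| + `|be| + `|la| + `|ga| + `|de|) * N.
Proof.
move=> j0; rewrite /linear_form !outer_step !inner_step entry_step // -/m.
have J0 : 0 <= J%:R :> R by rewrite ler0n.
have nu1 : 1 <= nu%:R :> R by rewrite ler1n.
have arr1 t k : 0 <= ((arr t k)%:R : R) <= 1 by rewrite ler0n lern1 leq_b1.
have arrJ t : 0 <= \sum_(k | k != ord0) ((arr t k)%:R : R) <= J%:R.
  apply/andP; split; first by apply: sumr_ge0 => k _; case/andP: (arr1 t k).
  apply: le_trans (_ : \sum_(k < J.+1 | k != ord0) 1 <= _).
    by apply: ler_sum => k _; case/andP: (arr1 t k).
  by rewrite sum_inner_cst mulr1.
have bo t : `|inner m (rev_ord t) - outer m t + (arr t ord0)%:R| <= N.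
  have := inner_ge0 m (rev_ord t); have := outer_ge0 m t.
  have := inner_served_le (rev_ord t); have := outer_served_le1 t.
  by have /andP[] := arr1 t ord0; rewrite ler_norml /N; lra.
have bi t : `|- inner m t + \sum_(k | k != ord0) (arr t k)%:R| <= N.
  have := inner_ge0 m t; have := inner_served_le t.
  by have /andP[] := arrJ t; rewrite ler_norml /N; lra.
have be' : `|- (m s j)%:R + (arr s j)%:R| <= N.
  have := entry_le_inner m s j0; have := inner_served_le s.
  have := ler0n R (m s j).
  by have /andP[] := arr1 s j; rewrite ler_norml /N; lra.
rewrite [X in `|X| <= _](_ : _ =
    al * (inner m (rev_ord s) - outer m s + (arr s ord0)%:R)
    + be * (- inner m s + \sum_(k | k != ord0) (arr s k)%:R)
    + la * (- (m s j)%:R + (arr s j)%:R)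
    + ga * (inner m (rev_ord (rev_ord s)) - outer m (rev_ord s) + (arr (rev_ord s) ord0)%:R)
    + de * (- inner m (rev_ord s) + \sum_(k | k != ord0) (arr (rev_ord s) k)%:R));
  last by ring.
rewrite !mulrDl; do !apply: le_trans (ler_normD _ _) (lerD _ _);
  by rewrite normrM ler_wpM2l.
Qed.

Hypotheses (J_gt0 : (0 < J)%N) (a_gt0 : 0 < a) (a_lt1 : a < 1).

Lemma linear_step_mean s j al be la ga de : j != ord0 ->
  arrival_avg a (fun arr => linear_form s j al be la ga de (step q sigma arr))
  = linear_form s j al be la ga de q + linear_drift s j al be la ga de m.
Proof.
move=> j0.
have J0 : J%:R != 0 :> R by rewrite pnatr_eq0 -lt0n.
have arrJ t : arrival_avg a (fun arr : 'M[bool]_(2, J.+1) =>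
    \sum_(k | k != ord0) (arr t k)%:R) = a.
  rewrite arrival_avg_sum.
  under eq_bigr => k k0 do rewrite arrival_avg_entry /arrival_mean (negPf k0).
  by rewrite sum_inner_cst mulrC divfK.
rewrite [X in arrival_avg _ X](_ : _ = fun arr : 'M[bool]_(2, J.+1) =>
   (linear_form s j al be la ga de q
    + (al * (inner m (rev_ord s) - outer m s) - be * inner m s
       - la * (m s j)%:R + ga * (inner m s - outer m (rev_ord s))
       - de * inner m (rev_ord s)))
   + (al * (arr s ord0)%:R
   + (be * (\sum_(k | k != ord0) (arr s k)%:R)
   + (la * (arr s j)%:R
   + (ga * (arr (rev_ord s) ord0)%:R
   + de * (\sum_(k | k != ord0) (arr (rev_ord s) k)%:R)))))); last first.
  apply/funext => arr; rewrite /linear_form !outer_step !inner_step entry_step // -/m.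
  by rewrite rev_ordK; ring.
rewrite !(arrival_avgD, arrival_avgM, arrival_avg_cst) !arrJ !arrival_avg_entry.
by rewrite /arrival_mean eqxx (negPf j0) /linear_form /linear_drift; ring.
Qed.

(** The exponent changes by at most [th * B <= 1 / 2], so [expR_le_quad] applies; its linear term
    averages to the drift and its quadratic term is at most [2 * (th * B) ^+ 2]. *)
Lemma exp_linear_step s j (al be la ga de th B : R) : j != ord0 -> 0 <= th ->
  (`|al| + `|be| + `|la| + `|ga| + `|de|) * N <= B -> th * B <= 2^-1 ->
  arrival_avg a (fun arr =>
    expR (- (th * linear_form s j al be la ga de (step q sigma arr))))
  <= expR (- (th * linear_form s j al be la ga de q))
     * (1 - th * linear_drift s j al be la ga de m + 2 * (th * B) ^+ 2).
Proof.
move=> j0 th0 HB thB; set L := linear_form _ _ _ _ _ _ _.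
have D arr : `|L (step q sigma arr) - L q| <= B.
  exact: le_trans (linear_step_bound _ _ _ _ _ _ _ j0) HB.
have B0 : 0 <= B by exact: le_trans (D (\matrix_(_, _) false)).
have thB0 : 0 <= th * B by exact: mulr_ge0.
(* The intermediate bound is affine in the new value of [L], so its average is computed exactly. *)
apply: (@le_trans _ _ (arrival_avg a (fun arr => expR (- (th * L q)) * (
    (1 + 2 * (th * B) ^+ 2 + th * L q) + - th * L (step q sigma arr))))).
  apply: arrival_avg_le => // arr.
  rewrite [- (th * L (step _ _ _))](_ : _ =
    - (th * L q) + (- (th * (L (step q sigma arr) - L q)))); last by ring.
  rewrite expRD ler_wpM2l ?expR_ge0 //.
  set x := - (th * (_ - _)).
  have nx : `|x| <= th * B by rewrite normrN normrM ger0_norm // ler_wpM2l.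
  apply: le_trans (expR_le_quad _) _; first by rewrite (le_trans (ler_norm _)) // (le_trans nx).
  have x2 : x ^+ 2 <= (th * B) ^+ 2.
    by rewrite -[x ^+ 2]real_normK ?num_real // lerXn2r ?nnegrE.
  rewrite [leRHS](_ : _ = 1 + x + 2 * (th * B) ^+ 2); last by rewrite /x; ring.
  by rewrite lerD2l ler_wpM2l.
have EL : arrival_avg a (fun arr => L (step q sigma arr))
    = L q + linear_drift s j al be la ga de m by exact: linear_step_mean.
rewrite (arrival_avgM a _ (fun arr => _ + - th * L (step q sigma arr))).
rewrite (arrival_avgD a (fun=> _) (fun arr => - th * L (step q sigma arr))).
rewrite arrival_avg_cst (arrival_avgM a _ (fun arr => L (step q sigma arr))) EL.
by rewrite ler_wpM2l ?expR_ge0 // le_eqVlt; apply/orP; left; apply/eqP; ring.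
Qed.

End Step.
End Network.

(** * Reduction of both policies to longest-queue service *)

Definition nonidling (J : nat) (q sigma : 'M[nat]_(2, J.+1)) : Prop :=
  forall s k, (0 < q s k)%N -> exists j, (0 < served q sigma s j)%N.

Section LongestQueueService.
Variables (J nu : nat).
Implicit Types (s : 'I_2) (j k : 'I_J.+1) (q sigma : 'M[nat]_(2, J.+1)).
Hypothesis nu_gt0 : (0 < nu)%N.

(* Amount of service, in units of [1 / nu]. *)
Definition work (f : 'I_J.+1 -> nat) : nat :=
  (nu * f ord0 + \sum_(j | j != ord0) f j)%N.

Lemma workE f : work f = (\sum_j (if j == ord0 then nu else 1) * f j)%N.
Proof.
rewrite /work [RHS](bigD1 ord0) //=; congr (_ + _)%N.
by apply: eq_bigr => j /negPf ->; rewrite mul1n.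
Qed.

Lemma leq_work f g : (forall j, (f j <= g j)%N) -> (work f <= work g)%N.
Proof. by move=> fg; rewrite !workE leq_sum // => j _; rewrite leq_mul2l fg orbT. Qed.

Lemma le_work f j : (f j <= work f)%N.
Proof.
rewrite workE (bigD1 j) //=; apply: leq_trans (leq_addr _ _).
by case: ifP => _; rewrite ?mul1n // leq_pmull.
Qed.

Lemma work_eq0 f : (forall j, f j = 0%N) -> work f = 0%N.
Proof. by move=> f0; rewrite workE big1 // => j _; rewrite f0 muln0. Qed.

Lemma longest_serviceP q sigma :
  (forall s, (work (sigma s) <= nu)%N) ->
  (forall s j k, (0 < sigma s j)%N -> (q s k <= q s j)%N) ->
  (forall s k, (0 < q s k)%N -> work (sigma s) = nu) ->
  longest_service nu q sigma /\ nonidling q sigma.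
Proof.
move=> cap longest full; split=> [m s|s].
  have mle j : (served q sigma s j <= sigma s j)%N by rewrite mxE geq_minl.
  split.
  - exact: leq_trans (leq_work mle) (cap s).
  - move=> j k m0; apply: longest; exact: leq_trans (mle j).
  (* With [nu] jobs in some queue, each queue offered service is a longest one, so holds at least
     [nu] jobs and wastes none of the offer. *)
  - move=> k qk; rewrite -[RHS](full s k) ?(leq_trans nu_gt0) //.
    rewrite -/(work (served q sigma s)) !workE.
    apply: eq_bigr => j _; rewrite mxE; congr (_ * _)%N; apply/minn_idPl.
    have [->//|sj] := posnP (sigma s j).
    rewrite (leq_trans (le_work _ _)) // (leq_trans (cap s)) // (leq_trans qk) //.
    exact: longest.
move=> k qk; have wnu := full s k qk.
have [j sj] : exists j, (0 < sigma s j)%N.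
  have [//|nj] := pselect (exists j, (0 < sigma s j)%N).
  move: nu_gt0; rewrite -wnu work_eq0 // => j; apply/eqP; rewrite -leqn0 leqNgt.
  by apply/negP => sj; apply: nj; exists j.
by exists j; rewrite mxE leq_min sj (leq_trans qk) // longest.
Qed.

Lemma batch_service q (c : {ffun 'I_2 -> 'I_J.+1}) :
  (forall s j, (q s j <= q s (c s))%N) ->
  longest_service nu q (batch nu c) /\ nonidling q (batch nu c).
Proof.
move=> longest.
have full s : work (batch nu c s) = nu.
  rewrite workE (bigD1 (c s)) //= big1 => [|j /negPf jc].
    by rewrite mxE eqxx addn0; case: ifP => _; rewrite ?muln1 ?mul1n.
  by rewrite mxE jc muln0.
apply: longest_serviceP => // [s|s j k]; first by rewrite full.
by rewrite mxE; case: eqP => [->|//] _; exact: longest.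
Qed.

Lemma station_sumE (R : realType) (f : 'I_J.+1 -> nat) :
  station_sum nu (fun j => (f j)%:R : R) = (work f)%:R / nu%:R.
Proof.
have nu0 : nu%:R != 0 :> R by rewrite pnatr_eq0 -lt0n.
rewrite /station_sum /work natrD natrM natr_sum mulrDl mulrAC divff // mul1r.
by congr (_ + _); rewrite mulrC.
Qed.

Lemma schedulesE (R : realType) sigma :
  schedules R nu sigma <-> forall s, (work (sigma s) <= nu)%N.
Proof.
have nu0 : 0 < nu%:R :> R by rewrite ltr0n.
by split=> S s; have := S s; rewrite station_sumE ler_pdivrMr // mul1r ler_nat.
Qed.

Lemma weightE (R : realType) q sigma s :
  weight R nu q sigma s = (work (fun j => q s j * sigma s j)%N)%:R / nu%:R.
Proof.
rewrite -station_sumE /weight /station_sum; congr (_ + _ * _).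
  by rewrite natrM.
by apply: eq_bigr => j _; rewrite natrM.
Qed.

(** Comparison with the full batch for a longest queue: in units of [1 / nu] it has weight [nu]
    times the maximal length, while the weight of [sigma] is at most that length times its work.
    Optimality forces equality, hence service on longest queues only and at full capacity. *)
Lemma max_weight_service (R : realType) q sigma :
  max_weight R nu q sigma -> longest_service nu q sigma /\ nonidling q sigma.
Proof.
move=> [/schedulesE cap opt].
have nu0 : 0 < nu%:R^-1 :> R by rewrite invr_gt0 ltr0n.
pose c := [ffun s => [arg max_(j > ord0) q s j]%N] : {ffun _ -> _}.
have cmax s k : (q s k <= q s (c s))%N.
  by rewrite ffunE; case: arg_maxnP => // j _ jmax; exact: jmax.
have cwork s (f : 'I_J.+1 -> nat) : work (fun j => f j * batch nu c s j)%N = (nu * f (c s))%N.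
  rewrite workE (bigD1 (c s)) //= big1 => [|j /negPf jc].
    by rewrite mxE eqxx addn0; case: ifP => _; rewrite ?muln1 ?mul1n // mulnC.
  by rewrite mxE jc !muln0.
have csched : schedules R nu (batch nu c).
  apply/schedulesE => s; have := cwork s (fun=> 1%N); rewrite muln1 => E.
  by rewrite -[leqRHS]E; apply: leq_work => j; rewrite mul1n.
have optn s : (nu * q s (c s) <= work (fun j => q s j * sigma s j))%N.
  by have := opt _ csched s; rewrite !weightE ler_pM2r // ler_nat cwork.
have wle s : (work (fun j => q s j * sigma s j) <= q s (c s) * work (sigma s))%N.
  rewrite !workE big_distrr leq_sum // => j _.
  by rewrite [leqRHS]mulnCA leq_mul2l; apply/orP; right; rewrite leq_mul2r cmax orbT.
apply: longest_serviceP => // [s j k sj|s k qk].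
- apply: leq_trans (cmax s k) _; rewrite leqNgt; apply/negP => qlt.
  have : (work (fun j => q s j * sigma s j) < q s (c s) * work (sigma s))%N.
    rewrite !workE big_distrr (bigD1 j) //= [X in (_ < X)%N](bigD1 j) //=.
    rewrite -addSn leq_add //.
      by rewrite [ltnRHS]mulnCA ltn_mul2l ltn_mul2r sj qlt; case: ifP; rewrite ?nu_gt0.
    apply: leq_sum => i _.
    by rewrite [leqRHS]mulnCA leq_mul2l; apply/orP; right; rewrite leq_mul2r cmax orbT.
  move/(leq_ltn_trans (optn s)); rewrite ltnNge [(nu * _)%N]mulnC leq_mul2l cap orbT.
  by [].
- apply/eqP; rewrite eqn_leq cap /=.
  have Mpos : (0 < q s (c s))%N by exact: leq_trans (cmax s k).
  by rewrite -(leq_pmul2l Mpos) mulnC (leq_trans (optn s)).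
Qed.

End LongestQueueService.

Section ServiceKernel.
Variables (R : realType) (J nu : nat) (a : R).
Implicit Types (q sigma : 'M[nat]_(2, J.+1)) (al : 'M[bool]_(2, J.+1)).

(** A common form for the two models: from each state, a finite mixture of longest-queue services.
    Entries of weight zero are unconstrained, because the policies restrict only choices of nonzero
    probability. *)
Definition service_kernel (K : 'M[nat]_(2, J.+1) -> 'M[nat]_(2, J.+1) -> R) : Prop :=
  forall q, exists l : seq (R * 'M[nat]_(2, J.+1)),
    [/\ forall i, i \in l -> 0 <= i.1,
        \sum_(i <- l) i.1 = 1,
        forall i, i \in l -> 0 < i.1 -> longest_service nu q i.2 /\ nonidling q i.2
      & forall q', K q q' = \sum_(i <- l) i.1 * step_law a q i.2 q'].

Hypothesis nu_gt0 : (0 < nu)%N.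

Lemma lqfs_service_kernel
    (kappa : 'M[nat]_(2, J.+1) -> {ffun 'I_2 -> 'I_J.+1} -> R) :
  longest_queue_policy kappa -> service_kernel (lqfs_kernel nu a kappa).
Proof.
move=> pol q; have [k0 klong ksum] := pol q.
exists [seq (kappa q c, batch nu c) | c <- index_enum {ffun 'I_2 -> 'I_J.+1}]; split.
- by move=> i /mapP[c _ ->] /=; exact: k0.
- by rewrite big_map.
- move=> i /mapP[c _ ->] /= kc; apply: batch_service => //.
  by apply: klong; rewrite gt_eqF.
- by move=> q'; rewrite big_map.
Qed.

Lemma switched_service_kernel
    (kappa : 'M[nat]_(2, J.+1) -> 'M[nat]_(2, J.+1) -> R) :
  max_weight_policy nu kappa -> service_kernel (switched_kernel nu a kappa).
Proof.
move=> pol q; have [k0 kmax ksum] := pol q.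
set r := finite_support 0 (schedules R nu) (kappa q) in ksum.
(* A sum over a set is 0 by default when the support is infinite; total mass 1 excludes that
   case. *)
have [rS r0] : [set` r] `<=` schedules R nu /\
    forall sigma, schedules R nu sigma -> sigma \notin r -> kappa q sigma = 0.
  move: ksum; rewrite /r; case: finite_supportP => [_|X XS X0 XE _]; last by split.
  by rewrite big_nil => /eqP; rewrite eq_sym oner_eq0.
(* The factor [f] may shrink the support, so the sum is brought back to the support [r] of
   [kappa q]. *)
have supp (f : 'M[nat]_(2, J.+1) -> R) :
    \sum_(sigma \in schedules R nu) kappa q sigma * f sigma
    = \sum_(sigma <- r) kappa q sigma * f sigma.
  rewrite (fsbigE r) ?finite_support_uniq //; last first.
    by move=> sigma Ss /r0 -> //; rewrite mul0r.
  rewrite big_seq_cond [RHS]big_seq_cond; apply: eq_bigl => sigma.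
  case: (boolP (sigma \in r)) => //= sr; rewrite mem_set //; exact: rS.
exists [seq (kappa q sigma, sigma) | sigma <- r].
split.
- by move=> i /mapP[sigma _ ->] /=; exact: k0.
- by rewrite big_map.
- move=> i /mapP[sigma _ ->] /= ks; apply: (@max_weight_service _ _ _ R) => //.
  by apply: kmax; rewrite gt_eqF.
- by move=> q'; rewrite big_map -supp.
Qed.

End ServiceKernel.

(** * Reachability of states with one long outer queue *)

Section Reachability.
Variables (R : realType) (J nu : nat) (a : R).
Implicit Types (s : 'I_2) (j k : 'I_J.+1) (q sigma : 'M[nat]_(2, J.+1)).
Hypotheses (nu_gt1 : (1 < nu)%N) (nu_ltJ : (nu < J)%N) (a_gt0 : 0 < a) (a_lt1 : a < 1).

Variable K : 'M[nat]_(2, J.+1) -> 'M[nat]_(2, J.+1) -> R.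
Hypothesis K_service : service_kernel nu a K.

Let J_gt0 : (0 < J)%N. Proof. exact: leq_ltn_trans nu_ltJ. Qed.

Definition reach q q' : Prop :=
  exists2 p, path (fun y z => 0 < K y z) q p & last q p = q'.

Lemma reach_refl q : reach q q. Proof. by exists [::]. Qed.

Lemma reach_trans q1 q2 q3 : reach q1 q2 -> reach q2 q3 -> reach q1 q3.
Proof.
move=> [p Kp <-] [p' Kp' <-]; exists (p ++ p'); last by rewrite last_cat.
by rewrite cat_path Kp.
Qed.

Lemma reach_step q (al : 'M[bool]_(2, J.+1)) : (forall s, al s ord0 = false) ->
  exists sigma, [/\ longest_service nu q sigma, nonidling q sigma
                  & reach q (step q sigma al)].
Proof.
move=> al0; have [l [l0 l1 lserv KE]] := K_service q.
have [[p sigma] il p0] : exists2 i, i \in l & 0 < i.1.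
  have [//|nl] := pselect (exists2 i, i \in l & 0 < i.1).
  move/eqP: l1; rewrite big_seq big1 ?(eq_sym 0) ?oner_eq0 // => i il.
  apply/eqP; rewrite eq_le l0 // andbT leNgt; apply/negP => i0.
  by apply: nl; exists i.
have [ls nid] := lserv _ il p0; exists sigma; split=> //.
exists [:: step q sigma al] => //=; rewrite andbT KE.
have step_ge0 q1 sg q2 : 0 <= step_law a q1 sg q2.
  by apply: sumr_ge0 => al' _; rewrite mulr_ge0 ?ler0n // arrival_law_ge0.
have step_gt0 : 0 < step_law a q sigma (step q sigma al).
  rewrite /step_law (bigD1 al) //= eqxx mulr1 ltr_wpDr ?arrival_law_gt0 //.
  by apply: sumr_ge0 => al' _; rewrite mulr_ge0 ?ler0n // arrival_law_ge0.
rewrite (big_rem _ il) /= ltr_wpDr ?mulr_gt0 // big_seq; apply: sumr_ge0 => i.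
by move=> /mem_rem /l0 i0; rewrite mulr_ge0.
Qed.

Definition inner_count q s : nat := (\sum_(j | j != ord0) q s j)%N.

(** The number of services still due: two for a job in an inner queue, one for a job in an outer
    queue. *)
Definition remaining_work q : nat := (\sum_s (q s ord0 + 2 * inner_count q s))%N.

Lemma outer_count_step q sigma al s :
  (step q sigma al s ord0 + served q sigma s ord0)%N
  = (q s ord0 + inner_count (served q sigma) (rev_ord s) + al s ord0)%N.
Proof.
rewrite /step mxE eqxx -/(inner_count (served q sigma) (rev_ord s)).
by have := served_le q sigma s ord0; lia.
Qed.

Lemma inner_count_step q sigma al s :
  (inner_count (step q sigma al) s + inner_count (served q sigma) s)%N
  = (inner_count q s + \sum_(j | j != ord0) al s j)%N.
Proof.
rewrite /inner_count -!big_split; apply: eq_bigr => j /negPf j0 /=.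
by rewrite /step mxE j0; have := served_le q sigma s j; lia.
Qed.

Lemma remaining_work_step q sigma :
  (remaining_work (step q sigma (const_mx false))
   + \sum_s (served q sigma s ord0 + inner_count (served q sigma) s))%N
  = remaining_work q.
Proof.
set m := served q sigma.
have swap : (\sum_s inner_count m (rev_ord s) = \sum_s inner_count m s)%N.
  by rewrite [RHS](reindex_inj rev_ord_inj).
rewrite /remaining_work -big_split /=.
apply/eqP; rewrite -(eqn_add2r (\sum_s inner_count m s)%N) -{2}swap -!big_split /=.
apply/eqP/eq_bigr => s _.
have := outer_count_step q sigma (const_mx false) s.
have := inner_count_step q sigma (const_mx false) s.
rewrite big1 => [|j _]; last by rewrite mxE.
rewrite [const_mx _ _ _]mxE -/m /=.
lia.
Qed.

(** With positive probability nothing arrives; a nonidling station then strictly decreases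
    [remaining_work] until it is zero. *)
Lemma reach_empty q : reach q (const_mx 0%N).
Proof.
have [n] := ubnP (remaining_work q); elim: n q => // n IH q qn.
have [->|q_neq0] := eqVneq q (const_mx 0%N); first exact: reach_refl.
have [|sigma [ls nid qr]] := @reach_step q (const_mx false); first by move=> s; rewrite mxE.
apply: reach_trans qr (IH _ _); rewrite ltnS in qn; apply: leq_trans qn.
rewrite -(remaining_work_step q sigma) -addn1 leq_add2l.
have [[s k] qsk] : exists p, (0 < q p.1 p.2)%N.
  have [//|nq] := pselect (exists p, (0 < q p.1 p.2)%N).
  case/eqP: q_neq0; apply/matrixP => s k; rewrite mxE; apply/eqP.
  by rewrite -leqn0 leqNgt; apply/negP => qsk; apply: nq; exists (s, k).
have [j mj] := nid _ _ qsk.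
rewrite (bigD1 s) //=; apply: leq_trans (leq_addr _ _).
have [j0|j0] := eqVneq j ord0; first by rewrite -j0 ltn_addr.
by rewrite /inner_count (bigD1 j) //= addnCA ltn_addr.
Qed.

Section Drive.
Variable s : 'I_2.

Let blast : 'M[bool]_(2, J.+1) := \matrix_(t, j) ((t == rev_ord s) && (j != ord0)).

Let drained q := (forall j, j != ord0 -> q s j = 0%N) /\ q (rev_ord s) ord0 = 0%N.

Let stock q := inner_count q (rev_ord s).

Let rev_neq : (rev_ord s == s) = false.
Proof. by case: s => -[|[|//]] ?; rewrite -val_eqE. Qed.

(** One step with an arrival at each inner queue of the other station and nowhere else. That station
    gains [J] jobs and serves at most [nu < J], so its stock grows. Once the stock is large it
    passes [nu > 1] jobs to the outer queue of [s], which loses at most one. *)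
Let drive q : drained q -> exists q', [/\ drained q', (stock q < stock q')%N,
  (J * nu <= stock q)%N -> (q s ord0 < q' s ord0)%N
  & reach q q'].
Proof.
move=> [q0 q1].
have [|sigma [ls nid qr]] := @reach_step q blast; first by move=> t; rewrite mxE andbF.
set m := served q sigma; set q' := step q sigma blast in qr.
have mq t j : (m t j <= q t j)%N by exact: served_le.
have q's j : j != ord0 -> q' s j = 0%N.
  move=> j0; rewrite /q' /step !mxE (negPf j0) (eq_sym s) rev_neq /= !addn0.
  by rewrite q0 // sub0n.
have q'r : q' (rev_ord s) ord0 = 0%N.
  have m0 : inner_count m s = 0%N.
    by apply: big1 => j j0; have := mq s j; rewrite q0 // leqn0 => /eqP.
  have := outer_count_step q sigma blast (rev_ord s).
  by rewrite rev_ordK [blast _ _]mxE andbF q1 -/q' -/m m0; lia.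
have stockE : (stock q' + inner_count m (rev_ord s))%N = (stock q + J)%N.
  rewrite /stock inner_count_step; congr (_ + _)%N.
  transitivity (\sum_(j < J.+1 | j != ord0) 1)%N.
    by apply: eq_bigr => j j0; rewrite mxE eqxx j0.
  by rewrite sum1_card cardC1 card_ord.
have outE : (q' s ord0 + m s ord0)%N = (q s ord0 + inner_count m (rev_ord s))%N.
  by rewrite outer_count_step mxE andbF addn0.
have nu_gt0 : (0 < nu)%N by exact: ltnW.
have m1 : (m s ord0 <= 1)%N by case: (outer_served nu_gt0 ls s) => [->|[-> _]].
have [mr _ mbusy] := ls (rev_ord s); rewrite -/m -/(inner_count m (rev_ord s)) in mr mbusy.
exists q'; split=> //.
- by move: mr; lia.
(* Pigeonhole: [J] inner queues shorter than [nu] hold at most [J * nu.-1] jobs. *)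
- move=> full; have [k qk] : exists k, (nu <= q (rev_ord s) k)%N.
    have [//|nk] := pselect (exists k, (nu <= q (rev_ord s) k)%N).
    have : (stock q <= J * nu.-1)%N.
      have -> : (J * nu.-1 = \sum_(j < J.+1 | j != ord0) nu.-1)%N.
        by rewrite sum_nat_const cardC1 card_ord.
      apply: leq_sum => j _; rewrite -ltnS prednK // ltnNge; apply/negP => qj.
      by apply: nk; exists j.
    have : (J * nu.-1 < J * nu)%N by rewrite ltn_pmul2l ?J_gt0 // prednK.
    lia.
  have := mbusy k qk; have := mq (rev_ord s) ord0; rewrite q1.
  have [->|/negPf] := eqVneq (m (rev_ord s) ord0) 0%N; lia.
Qed.

Lemma reach_outer (n : nat) : exists q,
  [/\ forall j, j != ord0 -> q s j = 0%N, q (rev_ord s) ord0 = 0%N,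
      (n <= q s ord0)%N & reach (const_mx 0%N) q].
Proof.
have fill N : exists q, [/\ drained q, (N <= stock q)%N & reach (const_mx 0%N) q].
  elim: N => [|N [q [dq Nq rq]]].
    by exists (const_mx 0%N); split; [split=> *; rewrite mxE|exact: leq0n|exact: reach_refl].
  have [q' [dq' lt_stock _ rq']] := drive dq.
  by exists q'; split=> //; [exact: leq_ltn_trans lt_stock|exact: reach_trans rq'].
suff [q [[q0 q1] _ nq rq]] : exists q, [/\ drained q, (J * nu <= stock q)%N,
  (n <= q s ord0)%N & reach (const_mx 0%N) q] by exists q.
elim: n => [|n [q [dq fq nq rq]]].
  by have [q [dq fq rq]] := fill (J * nu)%N; exists q.
have [q' [dq' lt_stock lt_outer rq']] := drive dq.
exists q'; split=> //; [exact: leq_trans (ltnW lt_stock)| |exact: reach_trans rq'].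
exact: leq_ltn_trans (lt_outer fq).
Qed.

End Drive.
End Reachability.

(** * The traffic intensity lies in the interior of the convex hull of the schedules *)

Section ConvexHull.
Variables (R : realType) (m n : nat) (A : set 'M[R]_(m, n)).
Hypothesis convexA : convex_set A.

Lemma convex_set_seg (x y : 'M[R]_(m, n)) (t : R) :
  0 <= t -> t <= 1 -> A x -> A y -> A (t *: x + (1 - t) *: y).
Proof.
move=> t0 t1 /mem_set Ax /mem_set Ay.
exact: set_mem (convexA (Itv01 t0 t1) Ax Ay).
Qed.

(** Dividing by the total weight lets the induction add one point at a time; a tail of total weight
    zero contributes nothing and is treated apart. *)
Lemma convex_set_sum (I : Type) (r : seq I) (w : I -> R) (p : I -> 'M[R]_(m, n)) :
  (forall i, 0 <= w i) -> (forall i, A (p i)) -> 0 < \sum_(i <- r) w i ->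
  A ((\sum_(i <- r) w i)^-1 *: \sum_(i <- r) w i *: p i).
Proof.
move=> w0 pA.
have zero_sum s : \sum_(i <- s) w i = 0 -> \sum_(i <- s) w i *: p i = 0.
  elim: s => [|i s IH]; first by rewrite !big_nil.
  rewrite !big_cons => /eqP; rewrite paddr_eq0 ?sumr_ge0 //.
  by move=> /andP[/eqP -> /eqP /IH ->]; rewrite scale0r addr0.
elim: r => [|i r IH]; first by rewrite big_nil ltxx.
rewrite !big_cons; set W := \sum_(j <- r) w j; set P := \sum_(j <- r) w j *: p j.
have W0 : 0 <= W by exact: sumr_ge0.
have [Wz|Wpos] := eqVneq W 0.
  have P0 : P = 0 by exact: zero_sum.
  rewrite P0 Wz !addr0 => wi; rewrite scalerA mulVf ?gt_eqF // scale1r; exact: pA.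
move=> wW; have {}Wpos : 0 < W by rewrite lt_neqAle eq_sym Wpos.
have wW0 : w i + W != 0 by rewrite gt_eqF.
have -> : (w i + W)^-1 *: (w i *: p i + P)
    = (w i / (w i + W)) *: p i + (1 - w i / (w i + W)) *: (W^-1 *: P).
  have -> : 1 - w i / (w i + W) = W / (w i + W) by field.
  rewrite scalerDr !scalerA; congr (_ *: _ + _ *: _); first by rewrite mulrC.
  by rewrite mulrAC divff ?mul1r // gt_eqF.
apply: convex_set_seg; [|by rewrite ler_pdivrMr // mul1r lerDl|exact: pA|exact: IH].
by rewrite divr_ge0 // ltW.
Qed.

End ConvexHull.

Lemma sum_option (R : nmodType) (I : finType) (F : option I -> R) :
  \sum_o F o = F None + \sum_i F (Some i).
Proof.
rewrite (bigD1 None) //=; congr (_ + _).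
rewrite (reindex_omap Some id) => [|[i|] //].
by apply: eq_bigl => i; rewrite eqxx.
Qed.

Section Admissible.
Variables (R : realType) (J nu : nat).
Hypothesis nu_gt0 : (0 < nu)%N.

Let M := 'M[R]_(2, J.+1).

Definition set_row (s : 'I_2) (u : 'I_J.+1 -> R) (y : M) : M :=
  \matrix_(t, j) if t == s then u j else y t j.

(* The vertices of [{u | 0 <= u, station_sum nu u <= 1}]; [None] is the origin. *)
Definition vertex (o : option 'I_J.+1) : 'I_J.+1 -> nat :=
  fun j => if o == Some j then if j == ord0 then 1%N else nu else 0%N.

Definition vertex_weight (u : 'I_J.+1 -> R) (o : option 'I_J.+1) : R :=
  if o is Some j then if j == ord0 then u j else u j / nu%:R
  else 1 - station_sum nu u.

Lemma sum_vertex_weight u : \sum_o vertex_weight u o = 1.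
Proof.
rewrite sum_option /= (bigD1 ord0) //=.
under eq_bigr => j j0 do rewrite (negPf j0).
by rewrite /station_sum -mulr_suml mulrC addrNK.
Qed.

Lemma sum_vertex u j : \sum_o vertex_weight u o * (vertex o j)%:R = u j.
Proof.
have nu0 : nu%:R != 0 :> R by rewrite pnatr_eq0 -lt0n.
rewrite (bigD1 (Some j)) //= /vertex eqxx big1 => [|o /negPf ->]; last by rewrite mulr0.
by case: ifP => _; rewrite addr0 ?mulr1 // divfK.
Qed.

(** The two stations are constrained separately, so one row is decomposed into vertices while the
    other is frozen; applied to both rows, this leaves matrices of vertices, which are schedules. *)
Lemma set_row_hull (A : set M) s u y : convex_set A -> (forall j, 0 <= u j) ->
  station_sum nu u <= 1 ->
  (forall o, A (set_row s (fun j => (vertex o j)%:R) y)) -> A (set_row s u y).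
Proof.
move=> cA u0 u1 Av.
have w0 o : 0 <= vertex_weight u o.
  case: o => [j|] /=; last by rewrite subr_ge0.
  by case: ifP => _ //; rewrite divr_ge0.
have := convex_set_sum (r := index_enum (option 'I_J.+1)) cA w0 Av.
rewrite sum_vertex_weight invr1 scale1r => /(_ ltr01).
congr (A _); apply/matrixP => t j; rewrite summxE.
under eq_bigr do rewrite !mxE.
rewrite mxE; case: ifP => _; first exact: sum_vertex.
by rewrite -mulr_suml sum_vertex_weight mul1r.
Qed.

Lemma schedule_hull (x : M) : (forall s j, 0 <= x s j) ->
  (forall s, station_sum nu (x s) <= 1) ->
  convex_hull ((fun sigma : 'M[nat]_(2, J.+1) => map_mx (fun k => k%:R : R) sigma)
    @` schedules R nu) x.
Proof.
move=> x0 x1 A [cA SA].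
have -> : x = set_row ord0 (x ord0) (set_row ord_max (x ord_max) x).
  apply/matrixP => s j; rewrite !mxE; have [->//|s0] := eqVneq s ord0.
  by case: eqP => [->|].
apply: set_row_hull => // o0.
have -> : set_row ord0 (fun j => (vertex o0 j)%:R) (set_row ord_max (x ord_max) x)
    = set_row ord_max (x ord_max) (set_row ord0 (fun j => (vertex o0 j)%:R) x).
  apply/matrixP => s j; rewrite !mxE; have [->|s0] := eqVneq s ord0; first by [].
  by case: ifP.
apply: set_row_hull => // o1; apply: SA.
exists (\matrix_(s, j) (if s == ord0 then vertex o0 j else vertex o1 j)%N).
  apply/(schedulesE nu_gt0) => s.
  have work_vertex o : (work nu (vertex o) <= nu)%N.
    rewrite workE; case: o => [j|]; last by rewrite big1 // => j _; rewrite muln0.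
    rewrite (bigD1 j) //= big1 => [|k /negPf kj].
      by rewrite /vertex eqxx addn0; case: ifP => _; rewrite ?muln1 ?mul1n.
    by rewrite /vertex (_ : (Some j == Some k) = (j == k)) // [j == k]eq_sym kj muln0.
  rewrite (_ : _ s = if s == ord0 then vertex o0 else vertex o1); first by case: ifP.
  by apply/funext => j; rewrite mxE; case: ifP.
apply/matrixP => s j; rewrite !mxE.
have [->|s0] := eqVneq s ord0; first by [].
by have -> : s = ord_max by apply/val_inj; case: s s0 => -[|[|]].
Qed.

Lemma admissible_interior (x : M) : (forall s j, 0 < x s j) ->
  (forall s, station_sum nu (x s) < 1) -> admissible nu x.
Proof.
move=> x0 x1; rewrite /admissible /interior /=.
pose d s := 1 - station_sum nu (x s).
have d0 s : 0 < d s by rewrite subr_gt0.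
pose slack : R := \big[Num.min/1]_s \big[Num.min/d s]_j x s j.
have slack0 : 0 < slack.
  by rewrite /slack; apply/bigmin_gtP; split=> // s _; apply/bigmin_gtP; split=> // j _.
have slackx s j : slack <= x s j.
  exact: le_trans (bigmin_le_cond _ _ (isT : true)) (bigmin_le_cond _ _ isT).
have slackd s : slack <= d s.
  by apply: le_trans (bigmin_le_cond _ _ (isT : true)) (bigmin_le_id _ _ _ _).
(* Raising every entry of a row by [r] raises [station_sum] by [r * N], hence the radius
   [slack / N]. *)
pose N : R := 1 + nu%:R^-1 * J%:R.
have N1 : 1 <= N by rewrite lerDl mulr_ge0 // invr_ge0.
have N0 : 0 < N by lra.
apply/nbhs_ballP; exists (slack / N) => /=; first exact: divr_gt0.
move=> y [_ xy]; apply: schedule_hull => [s j|s].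
  have := xy s j; rewrite /ball /= ltr_distlC => /andP[lo _].
  have := slackx s j; have : slack / N <= slack by rewrite ler_pdivrMr // ler_peMr // ltW.
  lra.
apply: le_trans (_ : station_sum nu (fun j => x s j + slack / N) <= _).
  have yx j : y s j <= x s j + slack / N.
    by have := xy s j; rewrite /ball /= ltr_distlC => /andP[_ /ltW].
  apply: lerD => //; rewrite ler_wpM2l ?invr_ge0 ?ler0n //.
  by apply: ler_sum => j _.
have -> : station_sum nu (fun j => x s j + slack / N) = station_sum nu (x s) + slack.
  rewrite /station_sum big_split /= sum_inner_cst mulrDr addrACA; congr (_ + _).
  transitivity (slack / N * N); last by rewrite divfK // gt_eqF.
  by rewrite {4}/N; ring.
by have := slackd s; rewrite /d; lra.
Qed.

End Admissible.

(** * Exponential forms with a penalty for unequal inner queues *)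

Section ExponentialForms.
Variables (R : realType) (J nu : nat) (a : R).
Implicit Types (s : 'I_2) (j k : 'I_J.+1) (q sigma : 'M[nat]_(2, J.+1)).
Hypotheses (J_gt0 : (0 < J)%N) (nu_gt0 : (0 < nu)%N) (a_gt0 : 0 < a) (a_lt1 : a < 1).

Definition station_form s (al be ga de : R) q : R :=
  al * outer R q s + be * inner R q s
  + ga * outer R q (rev_ord s) + de * inner R q (rev_ord s).

Definition station_drift s (al be ga de : R) (m : 'M[nat]_(2, J.+1)) : R :=
  al * (inner R m (rev_ord s) - outer R m s) + be * (a - inner R m s)
  + ga * (inner R m s - outer R m (rev_ord s)) + de * (a - inner R m (rev_ord s)).

Variables (th CD B eta : R).
Hypotheses (th_gt0 : 0 < th) (CD_ge0 : 0 <= CD).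
Hypotheses (thB : th * B <= 2^-1) (thB_eta : 2 * th * B ^+ 2 <= eta).

(* Serving a longest queue at [s] and uniform arrivals do not increase this to
   first order in [th], so that multiplying by it costs nothing in the drifts. *)
Definition imbalance s q : R :=
  \sum_(j < J.+1 | j != ord0) expR (th * CD * ((q s j)%:R - inner R q s / J%:R)).

Definition exp_form s (al be ga de : R) q : R :=
  expR (- (th * station_form s al be ga de q)) * imbalance s q.

Lemma imbalance_gt0 s q : 0 < imbalance s q.
Proof.
rewrite /imbalance (bigD1 (Ordinal (J_gt0 : (1 < J.+1)%N))) //=.
by rewrite ltr_pwDl ?expR_gt0 // sumr_ge0 // => j _; exact: expR_ge0.
Qed.

(** The penalty of queue [j] merges with the exponent, giving coefficient [- CD] to that queue and
    [CD / J] more to the inner sum; [exp_linear_step] then applies term by term. *)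
Lemma exp_formE s al be ga de q :
  exp_form s al be ga de q = \sum_(j < J.+1 | j != ord0)
    expR (- (th * linear_form s j al (be + CD / J%:R) (- CD) ga de q)).
Proof.
rewrite /exp_form mulr_sumr; apply: eq_bigr => j _; rewrite -expRD; congr expR.
by rewrite /station_form /linear_form; ring.
Qed.

(** The terms added by the penalty have a favourable sign: served inner queues are longest and so
    carry the largest penalty [phi], whence the sum of [phi j * m s j] is at least the mean of [phi]
    times the inner service. The uniform arrivals cancel, and [eta] absorbs the second-order
    term. *)
Lemma exp_form_step s al be ga de q sigma : longest_service nu q sigma ->
  (`|al| + `|be| + `|ga| + `|de| + 2 * CD) * (nu%:R + J%:R + 1) <= B ->
  arrival_avg a (fun arr => exp_form s al be ga de (step q sigma arr))
  <= exp_form s al be ga de q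
     * (1 - th * (station_drift s al be ga de (served q sigma) - eta)).
Proof.
move=> lq HB; set m := served q sigma; set D := station_drift _ _ _ _ _ _.
set e := expR (- (th * station_form s al be ga de q)).
pose phi j := expR (th * CD * ((q s j)%:R - inner R q s / J%:R)).
have J0 : 0 < J%:R :> R by rewrite ltr0n.
have nu1 : 1 <= nu%:R :> R by rewrite ler1n.
have N0 : 0 <= nu%:R + J%:R + 1 :> R by lra.
under [X in arrival_avg _ X]eq_fun => arr do rewrite exp_formE.
rewrite arrival_avg_sum.
apply: (@le_trans _ _ (\sum_(j < J.+1 | j != ord0)
  (e * phi j * (1 - th * (D - eta))
   + e * (th * CD) * (phi j * (inner R m s / J%:R) - phi j * (m s j)%:R)))).
  apply: ler_sum => j j0.
  set be' := be + CD / J%:R.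
  (* The penalty adds [CD / J%:R <= CD] to one coefficient and [- CD] as a new one, hence [2 * CD]
     in the norm. *)
  have B'B : (`|al| + `|be'| + `|- CD| + `|ga| + `|de|) * (nu%:R + J%:R + 1) <= B.
    apply: le_trans HB; rewrite ler_wpM2r // normrN (ger0_norm CD_ge0).
    have : `|be'| <= `|be| + CD.
      apply: le_trans (ler_normD _ _) _; rewrite lerD2l ger0_norm ?divr_ge0 ?ler0n //.
      by rewrite ler_pdivrMr // ler_peMr // ler1n.
    lra.
  apply: le_trans (exp_linear_step nu_gt0 lq J_gt0 a_gt0 a_lt1 s j0 (ltW th_gt0) B'B thB) _.
  have -> : expR (- (th * linear_form s j al be' (- CD) ga de q)) = e * phi j.
    by rewrite -expRD; congr expR; rewrite /be' /station_form /linear_form; ring.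
  have ep0 : 0 < e * phi j by rewrite mulr_gt0 ?expR_gt0.
  have Beta : 2 * (th * B) ^+ 2 <= th * eta.
    by rewrite [leLHS](_ : _ = th * (2 * th * B ^+ 2)) ?ler_pM2l //; ring.
  rewrite [leRHS](_ : _ = e * phi j * (1 - th * (D - eta)
      + th * CD * (inner R m s / J%:R - (m s j)%:R))); last by ring.
  rewrite ler_pM2l // /D /linear_drift /station_drift -/m /be'.
  lra.
rewrite big_split /= -!mulr_suml -!mulr_sumr sumrB -mulr_suml.
rewrite /exp_form -/e -/(imbalance s q) gerDl.
have [_ mmax _] := lq s.
apply: mulr_ge0_le0; first by rewrite mulr_ge0 ?expR_ge0 ?mulr_ge0 // ltW.
rewrite subr_le0 mulrA mulrAC mulrC mulr_suml; apply: ler_sum => j j0.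
have [->|m0] := posnP (m s j); first by rewrite mul0r mulr0.
rewrite mulrC ler_wpM2r ?ler0n // ler_pdivrMr //.
rewrite -[J%:R]mulr1 -sum_inner_cst.
rewrite mulr_sumr; apply: ler_sum => k k0; rewrite mulr1 ler_expR.
by rewrite ler_wpM2l ?(mulr_ge0 (ltW th_gt0)) // lerD2r ler_nat mmax.
Qed.

End ExponentialForms.

(** In this and the next two inequalities [x] and [y] are the values of [lead_exp] and [gap_exp],
    with drifts [dx] and [dy]. Here both are too small for their losses to consume the gain of
    [charge]. *)
Lemma drain_arith_idle (R : realFieldType) (gain eta loss x y dx dy : R) :
  0 < x -> 0 < y -> 0 <= eta -> eta <= gain / 4 -> gain <= 1 ->
  - loss <= dx -> - loss <= dy -> (x + y) * (loss + 1) <= gain / 4 ->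
  0 <= (gain - eta) + x * (dx - eta) + y * (dy - eta).
Proof.
move=> x0 y0 eta0 eta_le gain1 dx_ge dy_ge xy.
have : x * - (loss + 1) <= x * (dx - eta) by rewrite ler_pM2l //; lra.
have : y * - (loss + 1) <= y * (dy - eta) by rewrite ler_pM2l //; lra.
lra.
Qed.

Lemma drain_arith_busy (R : realFieldType) (eta x y dx dy : R) :
  0 < x -> 0 < y -> eta <= 4^-1 -> 2 <= dx -> 2 <= dy ->
  (x + y) / 4 <= x * (dx - eta) + y * (dy - eta).
Proof.
move=> x0 y0 eta_le dx_ge dy_ge.
have : x * (7 / 4) <= x * (dx - eta) by rewrite ler_pM2l //; lra.
have : y * (7 / 4) <= y * (dy - eta) by rewrite ler_pM2l //; lra.
lra.
Qed.

(** Only [dx] is favourable, but [y] is negligible compared with [x]. *)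
Lemma drain_arith_balanced (R : realFieldType) (eta loss x y dx dy : R) :
  0 < x -> 0 < y -> eta <= 4^-1 -> 0 <= loss -> 2 <= dx -> - loss <= dy ->
  y * (loss + 1) <= x / 4 ->
  (x + y) / 4 <= x * (dx - eta) + y * (dy - eta).
Proof.
move=> x0 y0 eta_le loss0 dx_ge dy_ge xy.
have : x * (7 / 4) <= x * (dx - eta) by rewrite ler_pM2l //; lra.
have : y * - (loss + 1) <= y * (dy - eta) by rewrite ler_pM2l //; lra.
have : y <= y * (loss + 1) by rewrite ler_peMr ?(ltW y0) //; lra.
lra.
Qed.

(** * Superharmonicity of the capped minimum of the four weights *)

Section Lyapunov.
Variables (R : realType) (J nu : nat) (a : R).
Implicit Types (s : 'I_2) (j k : 'I_J.+1) (q sigma : 'M[nat]_(2, J.+1)).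
Variables (th CD B eta b g C CP K1 K2 K : R).

(** [gain] is the drift of [charge] while [s] serves its outer queue; [- loss] bounds from below the
    drifts of [charge + C * lead] and [charge + C * gap]. *)
Definition gain := a * (a + b - 1).
Definition loss := nu%:R + 1 + C * (1 + g).

Let weight_norm (al be ga de : R) :=
  (`|al| + `|be| + `|ga| + `|de| + 2 * CD) * (nu%:R + J%:R + 1).

(** [B] bounds the step sizes of the four linear forms, [th] is the small scale of all exponents and
    [eta] the second-order error. The thresholds [K1], [K2], [K] decide where the extra terms of the
    weights become negligible. *)
Record drain_constants : Prop := {
  J_gt0 : (0 < J)%N; nu_gt0 : (0 < nu)%N; a_gt0 : 0 < a; a_lt1 : a < 1;
  th_gt0 : 0 < th; thB : th * B <= 2^-1; thB_eta : 2 * th * B ^+ 2 <= eta;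
  b_gt0 : 0 < b; b_le1 : b <= 1; ab_gt1 : 1 < a + b;
  abJ : a < (a - b) * J%:R;
  g_harmonic : g / J%:R + g / nu%:R = 1; g_ge1 : 1 <= g; g_le_nu : g <= nu%:R;
  C_ge0 : 0 <= C; C_large : nu%:R + 3 <= C * (g - 1 - a * g);
  CDE : CD = a + C * g + 1; CPE : CP = (a - b + C * g + CD) * nu%:R + 1;
  K1_ge0 : 0 <= K1; K2_ge0 : 0 <= K2; K_ge0 : 0 <= K;
  charge_norm : weight_norm a b 0 a <= B;
  charge_lead_norm : weight_norm (a + C) (b - C * g) (- (C * g)) (a + C * g / J%:R) <= B;
  charge_gap_norm : weight_norm (a + C) (b - C * g) 0 a <= B;
  charge_feed_norm : weight_norm a b (- CP) (a - CP / nu%:R) <= B;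
  eta_ge0 : 0 <= eta; eta_small : eta <= gain / 4;
  K1_large : expR (- (th * C * K1)) * (loss + 1) <= 4^-1;
  K2_large : 4 * (nu%:R + 3) <= expR (th * C * (K2 - K1 - nu%:R));
  K_large : expR (- (th * CP * (K - (nu%:R + J%:R)))) * (loss + CP + 1) <= gain / 4 }.

Hypothesis cst : drain_constants.

Local Notation imbalance := (imbalance th CD).
Local Notation exp_form := (exp_form th CD).
Local Notation station_drift := (station_drift a).

Lemma nu_ge1r : 1 <= nu%:R :> R. Proof. by rewrite ler1n (nu_gt0 cst). Qed.

Lemma J_gt0r : 0 < J%:R :> R. Proof. by rewrite ltr0n (J_gt0 cst). Qed.

Lemma CD_ge0 : 0 <= CD.
Proof.
rewrite (CDE cst) !addr_ge0 ?(ltW (a_gt0 cst)) // mulr_ge0 ?(C_ge0 cst) //.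
exact: le_trans (g_ge1 cst).
Qed.

Lemma imbalance_pos s q : 0 < imbalance s q.
Proof. by apply: imbalance_gt0; exact: J_gt0 cst. Qed.

Lemma exp_form_drift s al be ga de q sigma : longest_service nu q sigma ->
  weight_norm al be ga de <= B ->
  arrival_avg a (fun arr => exp_form s al be ga de (step q sigma arr))
  <= exp_form s al be ga de q
     * (1 - th * (station_drift s al be ga de (served q sigma) - eta)).
Proof.
move=> lq HB; exact: (exp_form_step (J_gt0 cst) (nu_gt0 cst) (a_gt0 cst) (a_lt1 cst)
  (th_gt0 cst) CD_ge0 (thB cst) (thB_eta cst) s lq HB).
Qed.

(* [drain_weight s] is for the phase in which [s] empties its outer queue and its
   inner queues fill up, [refill_weight s] for the one in which the other station
   empties its inner queues into the outer queue of [s]. *)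
Definition charge s q := a * outer R q s + b * inner R q s + a * inner R q (rev_ord s).
Definition lead s q := outer R q s + g / J%:R * inner R q (rev_ord s)
  - g * (outer R q (rev_ord s) + inner R q s).
Definition gap s q := outer R q s - g * inner R q s.
Definition feed s q := outer R q (rev_ord s) + inner R q (rev_ord s) / nu%:R.

Definition charge_exp s q := expR (- (th * charge s q)) * imbalance s q.
(** Sizes of the extra terms relative to [charge_exp]: [lead_exp] is at most 1 when [lead] is at
    least [K2], [gap_exp] when [gap] is at least [K2 - K1], and [feed_exp] when [feed] is at most
    [K]. *)
Definition lead_exp s q := expR (- (th * C * (lead s q - K2))).
Definition gap_exp s q := expR (- (th * C * (gap s q - K2 + K1))).
Definition feed_exp s q := expR (th * CP * (feed s q - K)).

(** Kept as a combination of [exp_form]s, to which [exp_form_drift] applies; the factored form is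
    used for comparisons. *)
Definition drain_weight s q : R :=
  exp_form s a b 0 a q
  + expR (th * C * K2)
    * exp_form s (a + C) (b - C * g) (- (C * g)) (a + C * g / J%:R) q
  + expR (th * C * (K2 - K1)) * exp_form s (a + C) (b - C * g) 0 a q.

Definition refill_weight s q : R :=
  exp_form s a b 0 a q
  + expR (- (th * CP * K)) * exp_form s a b (- CP) (a - CP / nu%:R) q.

Lemma exp_form_charge s q : exp_form s a b 0 a q = charge_exp s q.
Proof.
rewrite /exp_form /charge_exp; congr (expR _ * _).
by rewrite /station_form /charge; ring.
Qed.

Lemma exp_form_lead s q : expR (th * C * K2)
    * exp_form s (a + C) (b - C * g) (- (C * g)) (a + C * g / J%:R) q
  = charge_exp s q * lead_exp s q.
Proof.
rewrite /exp_form /charge_exp /lead_exp [LHS]mulrA -expRD [RHS]mulrAC -expRD; congr (expR _ * _).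
by rewrite /station_form /charge /lead; ring.
Qed.

Lemma exp_form_gap s q : expR (th * C * (K2 - K1))
    * exp_form s (a + C) (b - C * g) 0 a q = charge_exp s q * gap_exp s q.
Proof.
rewrite /exp_form /charge_exp /gap_exp [LHS]mulrA -expRD [RHS]mulrAC -expRD; congr (expR _ * _).
by rewrite /station_form /charge /gap; ring.
Qed.

Lemma exp_form_feed s q : expR (- (th * CP * K))
    * exp_form s a b (- CP) (a - CP / nu%:R) q = charge_exp s q * feed_exp s q.
Proof.
rewrite /exp_form /charge_exp /feed_exp [LHS]mulrA -expRD [RHS]mulrAC -expRD; congr (expR _ * _).
by rewrite /station_form /charge /feed; ring.
Qed.

Lemma drain_weightE s q : drain_weight s q = charge_exp s q * (1 + lead_exp s q + gap_exp s q).
Proof. by rewrite /drain_weight exp_form_charge exp_form_lead exp_form_gap; ring. Qed.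

Lemma refill_weightE s q : refill_weight s q = charge_exp s q * (1 + feed_exp s q).
Proof. by rewrite /refill_weight exp_form_charge exp_form_feed; ring. Qed.

Lemma charge_exp_gt0 s q : 0 < charge_exp s q.
Proof. by rewrite mulr_gt0 ?expR_gt0 ?imbalance_pos. Qed.

Ltac constants :=
  have ? := a_gt0 cst; have ? := a_lt1 cst; have ? := b_gt0 cst;
  have ? := b_le1 cst; have ? := g_ge1 cst; have ? := g_le_nu cst;
  have ? := C_ge0 cst; have ? := eta_ge0 cst; have ? := eta_small cst;
  have ? := nu_ge1r; have ? := J_gt0r.

Lemma C_gt0 : 0 < C.
Proof.
rewrite lt_neqAle (C_ge0 cst) andbT eq_sym; apply/negP => /eqP C0.
by have := C_large cst; have := nu_ge1r; rewrite C0 mul0r; lra.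
Qed.

Lemma ab_gt0 : 0 < a - b.
Proof. by have := lt_trans (a_gt0 cst) (abJ cst); rewrite pmulr_lgt0 ?J_gt0r. Qed.

Lemma CP_ge0 : 0 <= CP.
Proof.
constants; rewrite (CPE cst) (CDE cst).
apply: addr_ge0 => //; apply: mulr_ge0; last by rewrite ler0n.
have : 0 <= C * g by rewrite mulr_ge0 //; lra.
have := ab_gt0; lra.
Qed.

Section Step.
Variables (q sigma : 'M[nat]_(2, J.+1)).
Hypothesis lq : longest_service nu q sigma.
Local Notation m := (served q sigma).

Lemma outer_served_max s : (nu <= q s ord0)%N ->
  (forall j, j != ord0 -> (q s j < q s ord0)%N) -> outer R m s = 1.
Proof.
move=> qnu qmax; have [_ mmax mbusy] := lq s.
have := mbusy ord0 qnu; rewrite big1 => [|j j0].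
  rewrite addn0 -{2}[nu]muln1 => /eqP; rewrite eqn_pmul2l ?(nu_gt0 cst) // => /eqP.
  by rewrite /outer => ->.
apply/eqP; rewrite -leqn0 leqNgt; apply/negP => m0.
by have := mmax _ ord0 m0; rewrite leqNgt qmax.
Qed.

Lemma outer_served01 s : outer R m s = 0 \/ outer R m s = 1 /\ inner R m s = 0.
Proof.
have [m0|[m1 m0]] := outer_served (nu_gt0 cst) lq s; first by left; rewrite /outer m0.
by right; rewrite /outer /inner m1; split=> //; apply: big1 => j /m0 ->.
Qed.

Lemma busy_served s k : (nu <= q s k)%N ->
  nu%:R * outer R m s + inner R m s = nu%:R.
Proof.
have [_ _ mbusy] := lq s => /mbusy E.
by rewrite /outer /inner -natr_sum -natrM -natrD E.
Qed.

Lemma idle_workload s : (forall k, (q s k < nu)%N) ->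
  outer R q s + inner R q s / nu%:R <= nu%:R + J%:R.
Proof.
move=> qlt; apply: lerD; first by rewrite /outer ler_nat ltnW.
rewrite ler_pdivrMr ?ltr0n ?(nu_gt0 cst) // /inner.
apply: le_trans (_ : \sum_(k < J.+1 | k != ord0) nu%:R <= _).
  by apply: ler_sum => k _; rewrite ler_nat ltnW.
by rewrite sum_inner_cst mulrC.
Qed.

Lemma busyP s : (exists k, (nu <= q s k)%N) \/ forall k, (q s k < nu)%N.
Proof.
have [[k kP]|nk] := pselect (exists k, (nu <= q s k)%N); first by left; exists k.
by right=> k; rewrite ltnNge; apply/negP => kP; apply: nk; exists k.
Qed.

Definition charge_drift s := station_drift s a b 0 a m.

Lemma charge_drift_ge s : - (nu%:R + 1) <= charge_drift s.
Proof.
have a0 := a_gt0 cst; have a1 := a_lt1 cst; have b0 := b_gt0 cst; have b1 := b_le1 cst.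
have := inner_served_le R lq s; have := inner_ge0 R m s.
have := outer_served_le1 R (nu_gt0 cst) lq s; have := outer_ge0 R m s.
rewrite /charge_drift /station_drift => o0 o1 i0 i1.
have : b * inner R m s <= inner R m s by rewrite ler_piMl.
have : a * outer R m s <= outer R m s by rewrite ler_piMl // ltW.
have : 0 < a * a by rewrite mulr_gt0.
have : 0 < b * a by rewrite mulr_gt0.
lra.
Qed.

Lemma charge_drift_outer s : outer R m s = 1 -> charge_drift s = gain.
Proof.
have [h0 | [h1 h2]] := outer_served01 s; first by rewrite h0 => /eqP; rewrite eq_sym oner_eq0.
by move=> _; rewrite /charge_drift /station_drift h1 h2 /gain; ring.
Qed.

Lemma gain_gt0 : 0 < gain.
Proof. by constants; have ab := ab_gt1 cst; apply: mulr_gt0; lra. Qed.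

Lemma gain_le1 : gain <= 1.
Proof.
constants.
rewrite /gain; apply: le_trans (_ : 1 * 1 <= _); last by rewrite mulr1.
by have ab := ab_gt1 cst; apply: ler_pM; lra.
Qed.

Lemma loss_ge0 : 0 <= loss.
Proof.
have := nu_ge1r; have g1 := g_ge1 cst.
have : 0 <= C * (1 + g) by rewrite mulr_ge0 ?(C_ge0 cst) //; lra.
by rewrite /loss; lra.
Qed.

Lemma eta_le : eta <= 4^-1.
Proof. by have := eta_small cst; have := gain_le1; lra. Qed.

Definition charge_lead_drift s :=
  station_drift s (a + C) (b - C * g) (- (C * g)) (a + C * g / J%:R) m.
Definition charge_gap_drift s := station_drift s (a + C) (b - C * g) 0 a m.

Definition lead_drift s := - outer R m s + g * outer R m (rev_ord s)
  + g / nu%:R * inner R m (rev_ord s) - g * a + g / J%:R * a.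
Definition gap_drift s :=
  inner R m (rev_ord s) - outer R m s - g * a + g * inner R m s.

(** Inner service at [s] cancels in [lead]. Inner service at the other station has coefficient
    [1 - g / J%:R], which [g_harmonic] turns into [g / nu%:R], so each unit of work there
    contributes [g]. *)
Lemma charge_lead_driftE s : charge_lead_drift s = charge_drift s + C * lead_drift s.
Proof.
rewrite /charge_lead_drift /charge_drift /lead_drift /station_drift.
rewrite [g / nu%:R](_ : _ = 1 - g / J%:R); first by ring.
by rewrite -[X in X - _](g_harmonic cst) addrAC subrr add0r.
Qed.

Lemma charge_gap_driftE s : charge_gap_drift s = charge_drift s + C * gap_drift s.
Proof. by rewrite /charge_gap_drift /charge_drift /gap_drift /station_drift; ring. Qed.

Lemma gJ_ge0 : 0 <= g / J%:R * a.
Proof.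
have g1 := g_ge1 cst; rewrite mulr_ge0 ?(ltW (a_gt0 cst)) // divr_ge0 ?ler0n //.
exact: le_trans g1.
Qed.

Lemma charge_lead_drift_ge s : - loss <= charge_lead_drift s.
Proof.
have g1 := g_ge1 cst; have g0 : 0 <= g by exact: le_trans g1.
have : - (1 + g) <= lead_drift s.
  have : g * a <= g by rewrite ler_piMr // (ltW (a_lt1 cst)).
  have := mulr_ge0 g0 (outer_ge0 R m (rev_ord s)).
  have := mulr_ge0 (divr_ge0 g0 (ler0n R nu)) (inner_ge0 R m (rev_ord s)).
  have := outer_served_le1 R (nu_gt0 cst) lq s.
  by have := gJ_ge0; rewrite /lead_drift; lra.
move=> /(ler_wpM2l (C_ge0 cst)); have := charge_drift_ge s; rewrite charge_lead_driftE /loss; lra.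
Qed.

Lemma charge_gap_drift_ge s : - loss <= charge_gap_drift s.
Proof.
have g1 := g_ge1 cst; have g0 : 0 <= g by exact: le_trans g1.
have : - (1 + g) <= gap_drift s.
  have : g * a <= g by rewrite ler_piMr // (ltW (a_lt1 cst)).
  have := mulr_ge0 g0 (inner_ge0 R m s); have := inner_ge0 R m (rev_ord s).
  by have := outer_served_le1 R (nu_gt0 cst) lq s; rewrite /gap_drift; lra.
move=> /(ler_wpM2l (C_ge0 cst)); have := charge_drift_ge s; rewrite charge_gap_driftE /loss; lra.
Qed.

(** A busy station does one unit of work, worth [g], against at most [1 + a * g]. By [C_large] this
    contributes at least [nu + 3], and [charge] loses at most [nu + 1]. *)
Lemma charge_lead_drift_busy s k : (nu <= q (rev_ord s) k)%N -> 2 <= charge_lead_drift s.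
Proof.
move=> /busy_served busy.
have : g - 1 - a * g <= lead_drift s.
  have E : g / nu%:R * (nu%:R * outer R m (rev_ord s) + inner R m (rev_ord s)) = g.
    by rewrite busy divfK // pnatr_eq0 -lt0n (nu_gt0 cst).
  rewrite mulrDr mulrA divfK ?pnatr_eq0 -?lt0n ?(nu_gt0 cst) // in E.
  have := outer_served_le1 R (nu_gt0 cst) lq s.
  by have := gJ_ge0; rewrite /lead_drift; lra.
move=> /(ler_wpM2l (C_ge0 cst)); have := charge_drift_ge s; have := C_large cst.
rewrite charge_lead_driftE; lra.
Qed.

(** If the other station served its outer queue, that queue would be at least as long as the mean of
    its inner ones. So it serves [nu] inner jobs, all of which join the outer queue of [s], and
    [g <= nu]. *)
Lemma charge_gap_drift_busy s k : (nu <= q (rev_ord s) k)%N ->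
  J%:R * outer R q (rev_ord s) < inner R q (rev_ord s) -> 2 <= charge_gap_drift s.
Proof.
move=> /busy_served busy IJ.
have T0 : outer R m (rev_ord s) = 0.
  have [//|[T1 _]] := outer_served01 (rev_ord s).
  have [_ mmax _] := lq (rev_ord s).
  have m0 : (0 < m (rev_ord s) ord0)%N.
    by rewrite -(ltr_nat R); move: T1; rewrite /outer => ->.
  move: IJ; rewrite ltNge => /negP; case.
  apply: le_trans (_ : \sum_(k < J.+1 | k != ord0) outer R q (rev_ord s) <= _).
    by apply: ler_sum => j _; rewrite /outer ler_nat mmax.
  by rewrite sum_inner_cst.
have : g - 1 - a * g <= gap_drift s.
  move: busy; rewrite T0 mulr0 add0r /gap_drift => ->.
  have g1 := g_ge1 cst; have g0 : 0 <= g by exact: le_trans g1.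
  have := mulr_ge0 g0 (inner_ge0 R m s); have := g_le_nu cst.
  by have := outer_served_le1 R (nu_gt0 cst) lq s; lra.
move=> /(ler_wpM2l (C_ge0 cst)); have := charge_drift_ge s; have := C_large cst.
rewrite charge_gap_driftE; lra.
Qed.

Lemma thC_gt0 : 0 < th * C.
Proof. by rewrite mulr_gt0 ?(th_gt0 cst) ?C_gt0. Qed.

(** By [K2_large] the gap exceeds [nu], which makes the outer queue of [s] strictly longest and
    longer than [nu], hence served. *)
Lemma small_gap_exp s : gap_exp s q < 4 * (nu%:R + 3) -> charge_drift s = gain.
Proof.
move=> /lt_le_trans /(_ (K2_large cst)); rewrite ltr_expR => GK.
have Gnu : nu%:R < gap s q.
  have : th * C * nu%:R < th * C * gap s q by lra.
  by rewrite ltr_pM2l // thC_gt0.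
have g1 := g_ge1 cst.
have gi : inner R q s <= g * inner R q s by rewrite ler_peMl ?inner_ge0.
rewrite /gap in Gnu.
apply/charge_drift_outer/outer_served_max.
  by rewrite -(ler_nat R) -/(outer R q s); have := inner_ge0 R q s; lra.
move=> j j0; rewrite -(ltr_nat R) -/(outer R q s).
by have := entry_le_inner R q s j0; have := ler0n R nu; lra.
Qed.

Lemma idle_feed_exp s : (forall k, (q (rev_ord s) k < nu)%N) ->
  feed_exp s q * (loss + CP + 1) <= gain / 4.
Proof.
move=> /idle_workload Wle; apply: le_trans (K_large cst).
rewrite ler_wpM2r ?ler_expR //.
  by have := loss_ge0; have := CP_ge0; lra.
have := ler_wpM2l (mulr_ge0 (ltW (th_gt0 cst)) CP_ge0) Wle.
by rewrite /feed; lra.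
Qed.

(** The hypothesis says [lead s q <= gap s q], and the shift [K1] between the two exponents makes
    [gap_exp] the smaller by the factor in [K1_large]. *)
Lemma balanced_gap_exp s :
  inner R q (rev_ord s) <= J%:R * outer R q (rev_ord s) ->
  gap_exp s q * (loss + 1) <= lead_exp s q / 4.
Proof.
move=> IJ.
have -> : gap_exp s q = lead_exp s q * expR (th * C * (lead s q - gap s q) - th * C * K1).
  by rewrite /lead_exp -expRD /gap_exp; congr expR; ring.
rewrite -mulrA ler_pM2l ?expR_gt0 //; apply: le_trans (K1_large cst).
rewrite ler_wpM2r ?ler_expR //; first by have := loss_ge0; lra.
have g1 := g_ge1 cst; have g0 : 0 < g by exact: lt_le_trans g1.
have : lead s q - gap s q <= 0.
  have : g / J%:R * inner R q (rev_ord s) <= g * outer R q (rev_ord s).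
    by rewrite -mulrA ler_pM2l // ler_pdivrMl ?J_gt0r.
  by rewrite /lead /gap; lra.
by move=> /(ler_wpM2l (ltW thC_gt0)); lra.
Qed.

(** After division by [charge_exp] it suffices that the drifts, weighted by the three terms, have a
    nonnegative sum. The cases are whether the other station is busy and, if so, whether [gap_exp]
    is small. *)
Lemma drain_weight_descent s : drain_weight s q <= refill_weight s q ->
  arrival_avg a (fun arr => drain_weight s (step q sigma arr)) <= drain_weight s q.
Proof.
move=> XY.
have p1 : 0 < lead_exp s q by exact: expR_gt0.
have p2 : 0 < gap_exp s q by exact: expR_gt0.
suff key : 0 <= (charge_drift s - eta) + lead_exp s q * (charge_lead_drift s - eta)
    + gap_exp s q * (charge_gap_drift s - eta).
  apply: (@le_trans _ _ (charge_exp s q * ((1 - th * (charge_drift s - eta))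
      + lead_exp s q * (1 - th * (charge_lead_drift s - eta))
      + gap_exp s q * (1 - th * (charge_gap_drift s - eta))))).
    rewrite mulrDr [in X in X + _]mulrDr !mulrA -exp_form_lead -exp_form_gap -exp_form_charge.
    rewrite /drain_weight !arrival_avgD !arrival_avgM.
    rewrite -[X in _ <= _ + X]mulrA -[X in _ <= _ + X + _]mulrA.
    apply: lerD; [apply: lerD|].
    - exact: exp_form_drift lq (charge_norm cst).
    - by rewrite ler_pM2l ?expR_gt0 //; exact: exp_form_drift lq (charge_lead_norm cst).
    - by rewrite ler_pM2l ?expR_gt0 //; exact: exp_form_drift lq (charge_gap_norm cst).
  rewrite drain_weightE ler_pM2l ?charge_exp_gt0 //.
  have := mulr_ge0 (ltW (th_gt0 cst)) key; lra.
have eta0 := eta_ge0 cst; have eta4 := eta_small cst; have gain1 := gain_le1.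
have [[k kP]|idle] := busyP (rev_ord s); last first.
  (* The only use of minimality: an idle station has little feed, and the comparison with
     [refill_weight] passes this smallness to the two other terms. *)
  have sum_le : lead_exp s q + gap_exp s q <= feed_exp s q.
    by move: XY; rewrite drain_weightE refill_weightE ler_pM2l ?charge_exp_gt0 //; lra.
  have loss0 := loss_ge0; have CP0 := CP_ge0.
  have msum : (lead_exp s q + gap_exp s q) * (loss + 1) <= gain / 4.
    apply: le_trans (idle_feed_exp idle).
    by apply: ler_pM => //; [rewrite ltW // addr_gt0|lra|lra].
  rewrite small_gap_exp.
    exact: drain_arith_idle (charge_lead_drift_ge s) (charge_gap_drift_ge s) msum.
  have : (lead_exp s q + gap_exp s q) * 1 <= (lead_exp s q + gap_exp s q) * (loss + 1).
    by rewrite ler_pM2l ?addr_gt0 //; lra.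
  by have := nu_ge1r; lra.
have sum_ge : (lead_exp s q + gap_exp s q) / 4
    <= lead_exp s q * (charge_lead_drift s - eta) + gap_exp s q * (charge_gap_drift s - eta).
  have [IJ|IJ] := lerP (inner R q (rev_ord s)) (J%:R * outer R q (rev_ord s)).
    exact: drain_arith_balanced p1 p2 eta_le loss_ge0 (charge_lead_drift_busy kP)
      (charge_gap_drift_ge s) (balanced_gap_exp IJ).
  exact: drain_arith_busy p1 p2 eta_le (charge_lead_drift_busy kP) (charge_gap_drift_busy kP IJ).
rewrite -addrA; have gain0 := gain_gt0.
(* Either [s] serves its outer queue and [charge] gains, or [gap_exp / 4 >= nu + 3] outweighs the
   worst drift of [charge]. *)
have [small|large] := ltP (gap_exp s q) (4 * (nu%:R + 3)).
  by rewrite (small_gap_exp small); lra.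
by have := charge_drift_ge s; lra.
Qed.

Lemma max_inner s : exists2 j, j != ord0 &
  forall k, k != ord0 -> (q s k <= q s j)%N.
Proof.
pose j0 := lift ord0 (Ordinal (J_gt0 cst)) : 'I_J.+1.
have j0P : j0 != ord0 by [].
have [j jP jmax] := @arg_maxnP _ j0 (fun k => k != ord0) (q s) j0P.
by exists j.
Qed.

(** The constant terms left when the two exponents are compared in [refill_outer]; [level_bound] is
    the resulting bound on [charge]. *)
Definition level := CP * K + C * K2 + C * g * nu%:R + 3 * J%:R / th + a * nu%:R.
Definition level_bound : R :=
  2 * (J%:R * (level / ((a - b) * J%:R - a))) + level + nu%:R + nu%:R * level.

(** If [s] does not serve its outer queue, that queue exceeds the longest inner one by at most [nu].
    Comparing a lower bound on [refill_weight s] with an upper bound on [drain_weight (rev_ord s)]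
    then bounds [y], [Y] and [D], hence [charge], and the weight cannot lie below the cap. *)
Lemma refill_outer s : refill_weight s q <= drain_weight (rev_ord s) q ->
  refill_weight s q < expR (- (th * level_bound)) -> outer R m s = 1.
Proof.
constants; move=> YX Ysmall; have th0 := (th_gt0 cst).
have [[qnu qmax]|nmax] := pselect ((nu <= q s ord0)%N /\
    forall j, j != ord0 -> (q s j < q s ord0)%N); first exact: outer_served_max.
exfalso; have k1 := K1_ge0 cst; have k2 := K2_ge0 cst.
have thCD : 0 <= th * CD := mulr_ge0 (ltW th0) CD_ge0.
have [j j0 jmax] := max_inner s.
have qj k : k != ord0 -> (q s k)%:R <= (q s j)%:R :> R by move=> /jmax; rewrite ler_nat.
set x := outer R q s; set y := inner R q s.
set X := outer R q (rev_ord s); set Y := inner R q (rev_ord s).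
(* Excess of the longest inner queue over the mean; the penalty exists to control it. *)
set D := (q s j)%:R - y / J%:R.
have [x0 y0] := (outer_ge0 R q s, inner_ge0 R q s).
have [X0 Y0] := (outer_ge0 R q (rev_ord s), inner_ge0 R q (rev_ord s)).
rewrite -/x -/y -/X -/Y in x0 y0 X0 Y0.
have Jr0 := J_gt0r.
have D0 : 0 <= D.
  rewrite subr_ge0 ler_pdivrMr // mulrC -sum_inner_cst.
  by apply: ler_sum => k; exact: qj.
have xle : x <= y / J%:R + D + nu%:R.
  rewrite /D addrCA subrr addr0.
  have [qnu|qnu] := leqP nu (q s ord0); last first.
    have : x <= nu%:R by rewrite /x /outer ler_nat ltnW.
    by have := ler0n R (q s j); lra.
  have [k k0 kge] : exists2 k, k != ord0 & (q s ord0 <= q s k)%N.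
    have [//|nk] := pselect (exists2 k, k != ord0 & (q s ord0 <= q s k)%N).
    exfalso; apply: nmax; split=> // k k0; rewrite ltnNge; apply/negP => qk.
    by apply: nk; exists k.
  have : x <= (q s j)%:R by rewrite /x /outer ler_nat (leq_trans kge) // jmax.
  lra.
have W0 : 0 <= feed s q by rewrite /feed addr_ge0 // divr_ge0 // ler0n.
have lower : expR (- (th * (charge s q - CP * (feed s q - K) - CD * D))) <= refill_weight s q.
  rewrite refill_weightE [leRHS]mulrDr mulr1 ler_wpDl ?(ltW (charge_exp_gt0 _ _)) //.
  rewrite /charge_exp /feed_exp mulrAC -expRD /imbalance mulr_sumr (bigD1 j) //= -expRD.
  rewrite ler_wpDr //; first by apply: sumr_ge0 => k _; rewrite mulr_ge0 ?expR_ge0.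
  by rewrite ler_expR /D -/y; lra.
have lowerV : expR (- (th * charge s q)) <= refill_weight s q.
  rewrite refill_weightE [leRHS]mulrDr mulr1 ler_wpDr //.
    by rewrite mulr_ge0 ?(ltW (charge_exp_gt0 _ _)) ?expR_ge0.
  rewrite /charge_exp ler_peMr ?expR_ge0 // /imbalance (bigD1 j) //= ler_wpDr //.
    by apply: sumr_ge0 => k _; exact: expR_ge0.
  rewrite -[leLHS]expR0 ler_expR -/y -/D.
  exact: mulr_ge0.
set U := charge (rev_ord s) q - CD * Y - C * (K2 + g * D + g * nu%:R + g * Y).
(* The number of inner queues and the three terms cost a factor [3 * J], absorbed in the exponent
   since [3 * J <= expR (3 * J)]. *)
have upper : drain_weight (rev_ord s) q <= expR (- (th * (U - 3 * J%:R / th))).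
  have Phi : imbalance (rev_ord s) q <= J%:R * expR (th * CD * Y).
    rewrite -sum_inner_cst; apply: ler_sum => k k0.
    rewrite ler_expR ler_wpM2l //.
    have := entry_le_inner R q (rev_ord s) k0.
    by have := divr_ge0 Y0 (ltW Jr0); rewrite /Y; lra.
  set E := expR (th * (C * (K2 + g * D + g * nu%:R + g * Y))).
  have g0 : 0 <= g by lra.
  have gD : 0 <= g * D by rewrite mulr_ge0.
  have gY : 0 <= g * Y by rewrite mulr_ge0.
  have gnu : 0 <= g * nu%:R by rewrite mulr_ge0 // ler0n.
  have thC : 0 <= th * C by rewrite mulr_ge0 ?(ltW th0).
  have E1 : 1 <= E by rewrite -[leLHS]expR0 ler_expR mulrA mulr_ge0 //; lra.
  have EF : lead_exp (rev_ord s) q <= E.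
    have FQ : K2 - lead (rev_ord s) q <= K2 + g * D + g * nu%:R + g * Y.
      rewrite /lead rev_ordK -/x -/y -/X -/Y.
      have : g * x <= g * (y / J%:R + D + nu%:R) by rewrite ler_wpM2l.
      have : 0 <= g * X by rewrite mulr_ge0.
      lra.
    by rewrite ler_expR; have := ler_wpM2l thC FQ; lra.
  have EG : gap_exp (rev_ord s) q <= E.
    have GQ : K2 - K1 - gap (rev_ord s) q <= K2 + g * D + g * nu%:R + g * Y.
      by rewrite /gap -/X -/Y; lra.
    by rewrite ler_expR; have := ler_wpM2l thC GQ; lra.
  rewrite drain_weightE /charge_exp.
  have sum3 : 1 + lead_exp (rev_ord s) q + gap_exp (rev_ord s) q <= 3 * E by lra.
  have e0 := expR_ge0 (- (th * charge (rev_ord s) q)).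
  have : expR (- (th * charge (rev_ord s) q)) * imbalance (rev_ord s) q
         * (1 + lead_exp (rev_ord s) q + gap_exp (rev_ord s) q)
         <= expR (- (th * charge (rev_ord s) q)) * (J%:R * expR (th * CD * Y)) * (3 * E).
    apply: ler_pM => //; last by rewrite ler_wpM2l.
      by rewrite mulr_ge0 ?(ltW (imbalance_pos _ _)).
    by rewrite !addr_ge0 ?expR_ge0.
  move/le_trans; apply.
  rewrite [leLHS](_ : _ = 3 * J%:R *
    (expR (- (th * charge (rev_ord s) q)) * expR (th * CD * Y) * E)); last by ring.
  rewrite /E -!expRD.
  rewrite [X in _ <= expR X](_ : _ = 3 * J%:R + (- (th * charge (rev_ord s) q)
     + th * CD * Y + th * (C * (K2 + g * D + g * nu%:R + g * Y)))).
    rewrite [leRHS]expRD ler_wpM2r ?expR_ge0 //.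
    by have := expR_ge1Dx (3 * J%:R : R); lra.
  rewrite /U; field.
  exact: lt0r_neq0.
have cmp : U - 3 * J%:R / th <= charge s q - CP * (feed s q - K) - CD * D.
  have := le_trans lower (le_trans YX upper).
  by rewrite ler_expR lerN2 ler_pM2l.
(* [CP] is chosen so that the feed term pays for everything multiplying [Y] and still leaves one
   copy of [feed]. *)
have CPW : (a - b + C * g + CD) * Y + feed s q <= CP * feed s q.
  rewrite (CPE cst) [leRHS]mulrDl mul1r lerD2r -[leRHS]mulrA ler_wpM2l //.
    have : 0 <= C * g by rewrite mulr_ge0 //; lra.
    by have := ab_gt0; have := CD_ge0; lra.
  rewrite /feed -/X -/Y mulrDr mulrCA divff ?mulr1 ?gt_eqF ?ltr0n ?(nu_gt0 cst) //.
  by rewrite lerDr mulr_ge0 // ler0n.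
(* [D] keeps coefficient [CD - C * g - a = 1], and [y / J%:R] keeps [(a - b) * J%:R - a], positive
   by [abJ]. *)
have main : ((a - b) * J%:R - a) * (y / J%:R) + D + feed s q <= level.
  have ax : a * x <= a * (y / J%:R + D + nu%:R) by rewrite ler_pM2l.
  have aX : 0 <= a * X by rewrite mulr_ge0 // ltW.
  have VV : charge s q - charge (rev_ord s) q
      = a * x - a * X + (a - b) * Y - (a - b) * J%:R * (y / J%:R).
    have -> : (a - b) * J%:R * (y / J%:R) = (a - b) * y.
      by rewrite -[LHS]mulrA [J%:R * _]mulrC divfK ?gt_eqF.
    by rewrite /charge rev_ordK -/x -/y -/X -/Y; ring.
  move: cmp ax aX VV CPW; rewrite /U /level (CDE cst); lra.
have slack : 0 < (a - b) * J%:R - a by rewrite subr_gt0 (abJ cst).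
have yJ0 : 0 <= y / J%:R by rewrite divr_ge0 // ltW.
have syJ := mulr_ge0 (ltW slack) yJ0.
have yle : y <= J%:R * (level / ((a - b) * J%:R - a)).
  by rewrite -ler_pdivrMl // mulrC ler_pdivlMr // mulrC; lra.
have Yle : Y <= nu%:R * level.
  have : Y / nu%:R <= level by move: main; rewrite /feed -/X -/Y; lra.
  by rewrite ler_pdivrMr ?ltr0n ?(nu_gt0 cst) // mulrC.
have yJle : y / J%:R <= y by rewrite ler_pdivrMr // ler_peMr // ler1n (J_gt0 cst).
have Vle : charge s q <= level_bound.
  have : a * x <= x by rewrite ler_piMl // ltW.
  have : b * y <= y by rewrite ler_piMl.
  have : a * Y <= Y by rewrite ler_piMl // ltW.
  by rewrite /charge /level_bound -/x -/y -/Y; lra.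
have := le_lt_trans lowerV Ysmall; rewrite ltr_expR ltrN2 ltr_pM2l //.
by rewrite ltNge Vle.
Qed.

(** By [refill_outer] the station [s] serves its outer queue, so [charge] gains and no job reaches
    the outer queue of the other station. If that station is busy, [feed] does not grow since
    [a <= nu]; if it is idle, [feed_exp] is negligible. *)
Lemma refill_weight_descent s : refill_weight s q <= drain_weight (rev_ord s) q ->
  refill_weight s q < expR (- (th * level_bound)) ->
  arrival_avg a (fun arr => refill_weight s (step q sigma arr)) <= refill_weight s q.
Proof.
move=> YX Ysmall; have m1 := refill_outer YX Ysmall.
have m0 : inner R m s = 0.
  have [h0|[_ //]] := outer_served01 s.
  by move: m1 => /eqP; rewrite h0 eq_sym oner_eq0.
set dW := station_drift s a b (- CP) (a - CP / nu%:R) m.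
have p1 : 0 < feed_exp s q by exact: expR_gt0.
suff key : 0 <= (charge_drift s - eta) + feed_exp s q * (dW - eta).
  apply: (@le_trans _ _ (charge_exp s q * ((1 - th * (charge_drift s - eta))
      + feed_exp s q * (1 - th * (dW - eta))))).
    rewrite mulrDr !mulrA -exp_form_feed -exp_form_charge.
    rewrite /refill_weight !arrival_avgD !arrival_avgM -[X in _ <= _ + X]mulrA.
    apply: lerD; first exact: exp_form_drift lq (charge_norm cst).
    by rewrite ler_pM2l ?expR_gt0 //; exact: exp_form_drift lq (charge_feed_norm cst).
  rewrite refill_weightE ler_pM2l ?charge_exp_gt0 //.
  have := mulr_ge0 (ltW (th_gt0 cst)) key; lra.
rewrite (charge_drift_outer m1).
have CP0 := CP_ge0; have gain0 := gain_gt0; have gain1 := gain_le1.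
have nu0 : nu%:R != 0 :> R by rewrite pnatr_eq0 -lt0n (nu_gt0 cst).
set w := a / nu%:R - (nu%:R * outer R m (rev_ord s) + inner R m (rev_ord s)) / nu%:R.
have dWE : dW = gain - CP * w.
  by rewrite -(charge_drift_outer m1) /dW /w /charge_drift /station_drift m0; field.
have anu : a / nu%:R <= 1.
  rewrite ler_pdivrMr ?ltr0n ?(nu_gt0 cst) // mul1r.
  by have := nu_ge1r; have := a_lt1 cst; lra.
have [[k kP]|idle] := busyP (rev_ord s).
  have w0 : CP * w <= 0.
    by apply: mulr_ge0_le0 => //; rewrite /w (busy_served kP) divff //; lra.
  have eta4 := eta_small cst.
  have : 0 <= feed_exp s q * (dW - eta).
    by rewrite mulr_ge0 ?(ltW p1) //; have := eta_small cst; lra.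
  lra.
have w1 : CP * w <= CP.
  rewrite ler_piMr // /w; apply: le_trans anu; rewrite gerBl divr_ge0 ?ler0n //.
  by rewrite addr_ge0 ?mulr_ge0 ?ler0n ?inner_ge0 ?outer_ge0.
have msmall := idle_feed_exp idle; have loss0 := loss_ge0.
have eta0 := eta_ge0 cst; have eta4 := eta_small cst.
have : feed_exp s q * - (loss + CP + 1) <= feed_exp s q * (dW - eta) by rewrite ler_pM2l //; lra.
lra.
Qed.

End Step.

Definition potential q : R :=
  Num.min (Num.min (drain_weight ord0 q) (drain_weight ord_max q))
          (Num.min (refill_weight ord0 q) (refill_weight ord_max q)).

Definition capped_potential q : R := Num.min (potential q) (expR (- (th * level_bound))).

Lemma potential_le_drain s q : potential q <= drain_weight s q.
Proof.
have [->|->] : s = ord0 \/ s = ord_max.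
  case: s => -[|[|//]] ? ; [left|right]; exact: val_inj.
- by rewrite /potential !ge_min lexx.
- by rewrite /potential !ge_min lexx orbT.
Qed.

Lemma potential_le_refill s q : potential q <= refill_weight s q.
Proof.
have [->|->] : s = ord0 \/ s = ord_max.
  case: s => -[|[|//]] ? ; [left|right]; exact: val_inj.
- by rewrite /potential !ge_min lexx !orbT.
- by rewrite /potential !ge_min lexx !orbT.
Qed.

Lemma potentialP q :
  exists s, potential q = drain_weight s q \/ potential q = refill_weight s q.
Proof.
have minP (x y : R) : Num.min x y = x \/ Num.min x y = y.
  by case: (leP x y) => _; [left|right].
rewrite /potential.
have [->|->] := minP (Num.min (drain_weight ord0 q) (drain_weight ord_max q))
                     (Num.min (refill_weight ord0 q) (refill_weight ord_max q)).
- have [->|->] := minP (drain_weight ord0 q) (drain_weight ord_max q).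
  + by exists ord0; left.
  + by exists ord_max; left.
- have [->|->] := minP (refill_weight ord0 q) (refill_weight ord_max q).
  + by exists ord0; right.
  + by exists ord_max; right.
Qed.

(** The minimum lies below each weight everywhere and equals one of them, or the cap, at [q]; the
    descent of that one suffices. *)
Lemma capped_potential_descent q sigma : longest_service nu q sigma ->
  arrival_avg a (fun arr => capped_potential (step q sigma arr)) <= capped_potential q.
Proof.
move=> lq; have avg_le := @arrival_avg_le R J a (J_gt0 cst) (a_gt0 cst) (a_lt1 cst).
rewrite [leRHS]/capped_potential; case: (leP (potential q) _) => [potle|capgt]; last first.
  rewrite -[leRHS](@arrival_avg_cst R J a); apply: avg_le => arr.
  by rewrite /capped_potential ge_min lexx orbT.
have [s [sE|sE]] := potentialP q; rewrite sE.
  apply: le_trans (drain_weight_descent lq _); last by rewrite -sE potential_le_refill.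
  by apply: avg_le => arr; rewrite /capped_potential ge_min potential_le_drain.
(* At equality the cap itself serves as the bound; [refill_weight_descent] needs a weight strictly
   below it. *)
move: potle; rewrite sE le_eqVlt => /orP[/eqP ->|small].
  rewrite -[leRHS](@arrival_avg_cst R J a); apply: avg_le => arr.
  by rewrite /capped_potential ge_min lexx orbT.
apply: le_trans (refill_weight_descent lq _ small); last by rewrite -sE potential_le_drain.
by apply: avg_le => arr; rewrite /capped_potential ge_min potential_le_refill.
Qed.

Lemma capped_potential_gt0 q : 0 < capped_potential q.
Proof.
have drain0 s : 0 < drain_weight s q.
  by rewrite drain_weightE mulr_gt0 ?charge_exp_gt0 // !addr_gt0 ?expR_gt0.
have refill0 s : 0 < refill_weight s q.
  by rewrite refill_weightE mulr_gt0 ?charge_exp_gt0 // addr_gt0 ?expR_gt0.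
by rewrite /capped_potential /potential !lt_min !drain0 !refill0 expR_gt0.
Qed.

Lemma capped_potential_small s (r : R) : 0 < r -> exists x : R, forall q,
  (forall j, j != ord0 -> q s j = 0%N) -> q (rev_ord s) ord0 = 0%N ->
  x <= outer R q s -> capped_potential q < r.
Proof.
move=> r0; have th0 := th_gt0 cst; have a0 := a_gt0 cst; have J0 := J_gt0r.
(* [K2] makes [lead_exp] and [gap_exp] at most 1, so [drain_weight s] is at most
   [3 * J * expR (- (th * a * x))]; the second summand brings this below [r]. *)
exists (K2 + 3 * J%:R / (r * (th * a))) => q q0 q1 xle.
have inner0 : inner R q s = 0 by apply: big1 => j /q0 ->.
have outer0 : outer R q (rev_ord s) = 0 by rewrite /outer q1.
have Y0 := inner_ge0 R q (rev_ord s).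
have K20 := K2_ge0 cst; have K10 := K1_ge0 cst.
have C0 := C_gt0; have g1 := g_ge1 cst.
have tha : 0 < th * a by rewrite mulr_gt0.
have z0 : 0 <= 3 * J%:R / (r * (th * a)) by rewrite divr_ge0 // ?mulr_ge0 // ltW.
have thC : 0 <= th * C by rewrite mulr_ge0 // ltW.
have F1 : lead_exp s q <= 1.
  rewrite -[leRHS]expR0 ler_expR oppr_le0 mulr_ge0 // /lead inner0 outer0.
  have : 0 <= g / J%:R * inner R q (rev_ord s) by rewrite mulr_ge0 // divr_ge0 //; lra.
  by lra.
have G1 : gap_exp s q <= 1.
  by rewrite -[leRHS]expR0 ler_expR oppr_le0 mulr_ge0 // /gap inner0; lra.
have I1 : imbalance s q <= J%:R.
  rewrite -[J%:R]mulr1 -sum_inner_cst; apply: ler_sum => j j0.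
  by rewrite -[leRHS]expR0 ler_expR inner0 q0 // mul0r subr0 mulr0.
set x := outer R q s in xle.
have Vx : expR (- (th * charge s q)) <= expR (- (th * a * x)).
  rewrite ler_expR lerN2 -mulrA ler_pM2l // /charge inner0 -/x.
  have : 0 <= a * inner R q (rev_ord s) by rewrite mulr_ge0 // ltW.
  lra.
have : drain_weight s q <= expR (- (th * a * x)) * J%:R * 3.
  rewrite drain_weightE /charge_exp; apply: ler_pM; [|by rewrite !addr_ge0 ?expR_ge0| |lra].
    by rewrite mulr_ge0 ?expR_ge0 // ltW // imbalance_pos.
  by apply: ler_pM; rewrite ?expR_ge0 ?(ltW (imbalance_pos _ _)).
move=> drain_le.
rewrite /capped_potential gt_min; apply/orP; left.
apply: le_lt_trans (potential_le_drain s q) _; apply: le_lt_trans drain_le _.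
rewrite -(@ltr_pM2l _ (expR (th * a * x))) ?expR_gt0 // !mulrA -expRD subrr expR0 mul1r.
have xge : 3 * J%:R / r <= th * a * x.
  have : th * a * (3 * J%:R / (r * (th * a))) = 3 * J%:R / r.
    by field; rewrite !gt_eqF.
  have : th * a * (K2 + 3 * J%:R / (r * (th * a))) <= th * a * x by rewrite ler_pM2l.
  have : 0 <= th * a * K2 by rewrite mulr_ge0 // ltW.
  lra.
rewrite mulrC -ltr_pdivrMr //; apply: le_lt_trans xge _.
by have := expR_ge1Dx (th * a * x); lra.
Qed.

End Lyapunov.

(** * Choice of the constants *)

Lemma exp_decay (R : realType) (t M r : R) : 0 < t -> 0 <= M -> 0 < r ->
  exists2 K, 0 <= K & expR (- (t * K)) * M <= r.
Proof.
move=> t0 M0 r0; have rt0 : 0 < r * t by rewrite mulr_gt0.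
exists (M / (r * t)); first by rewrite divr_ge0 // ltW.
rewrite expRN mulrC ler_pdivrMr ?expR_gt0 //.
have -> : t * (M / (r * t)) = M / r by field; rewrite !gt_eqF.
rewrite -ler_pdivrMl // mulrC; apply: le_trans (expR_ge1Dx _).
by rewrite lerDr.
Qed.

(* [a * (2 * x - 1) > x] gives room for [b] slightly larger than [1 - a]; the
   upper bound on [a] says exactly that [g - 1 > a * g + a / x]. *)
Lemma station_constants (R : realFieldType) (x n a : R) :
  2 <= n -> n + 1 <= x -> 0 < a -> a < 1 -> x < a * (2 * x - 1) ->
  (x + 1) * (x + n) < (1 - a) * (n * x ^+ 2 + x + n) ->
  exists b g : R, [/\ 0 < b, b <= 1, 1 < a + b & a < (a - b) * x]
    /\ [/\ g / x + g / n = 1, 1 <= g, g <= n & 0 < g - 1 - a * g].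
Proof.
move=> n2 nx a0 a1 a_low a_up.
have x0 : 0 < x by lra.
have n0 : 0 < n by lra.
have xn0 : 0 < x + n by lra.
(* With [b = 1 - a + e], the requirement [a < (a - b) * x] reads [e * x < (2 * a - 1) * x - a], and
   [e] takes half of the room. The value of [g] solves [g / x + g / n = 1]. *)
exists (1 - a + ((2 * a - 1) * x - a) / (2 * x)), (n * x / (x + n)); split.
  set e := _ / _; have xe : e * (2 * x) = (2 * a - 1) * x - a.
    by rewrite /e divfK // gt_eqF //; lra.
  have e0 : 0 < e by rewrite divr_gt0 //; lra.
  have ea : e <= a by rewrite /e ler_pdivrMr; lra.
  by clearbody e; split; lra.
split.
- by field; rewrite !gt_eqF.
- rewrite ler_pdivlMr // mul1r.
  have : 0 <= (n - 2) * (x - 1) by rewrite mulr_ge0; lra.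
  lra.
- by rewrite ler_pdivrMr // ler_pM2l //; lra.
- have -> : n * x / (x + n) - 1 - a * (n * x / (x + n))
      = ((1 - a) * (n * x) - (x + n)) / (x + n) by field; rewrite gt_eqF.
  rewrite divr_gt0 // subr_gt0 -(ltr_pM2r x0).
  have : 0 < a * (x + n) by rewrite mulr_gt0.
  lra.
Qed.

Lemma common_bound (R : realDomainType) (w1 w2 w3 w4 : R) :
  0 <= w1 -> 0 <= w2 -> 0 <= w3 -> 0 <= w4 ->
  exists2 B, 1 <= B & [/\ w1 <= B, w2 <= B, w3 <= B & w4 <= B].
Proof.
by move=> h1 h2 h3 h4; exists (w1 + w2 + w3 + w4 + 1); [lra|split; lra].
Qed.

Lemma small_step (R : realFieldType) (B eta : R) : 1 <= B -> 0 < eta -> eta <= 1 ->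
  exists2 th, 0 < th & th * B <= 2^-1 /\ 2 * th * B ^+ 2 <= eta.
Proof.
move=> B1 eta0 eta1; have B0 : 0 < B by exact: lt_le_trans B1.
exists (eta / (2 * B ^+ 2)); first by rewrite divr_gt0 // mulr_gt0 // exprn_gt0.
split; last by rewrite le_eqVlt; apply/orP; left; apply/eqP; field; rewrite gt_eqF.
have -> : eta / (2 * B ^+ 2) * B = eta / (2 * B) by field; rewrite gt_eqF.
by rewrite ler_pdivrMr ?mulr_gt0 //; lra.
Qed.

(** There is no circularity: [b] and [g] come first, then [C], [CD] and [CP], then [eta] and [B],
    then [th], and the thresholds last, with [K2] after [K1]. *)
Lemma drain_constants_exist (R : realType) (J nu : nat) (a : R) :
  (0 < J)%N -> 0 < a -> a < 1 -> (1 < nu)%N -> (nu < J)%N ->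
  J%:R / (2 * J%:R - 1) < a ->
  a < 1 - ((J%:R + 1) * (J%:R + nu%:R)) / (nu%:R * J%:R ^+ 2 + J%:R + nu%:R) ->
  exists th CD B eta b g C CP K1 K2 K,
    drain_constants J nu a th CD B eta b g C CP K1 K2 K.
Proof.
move=> J_gt0 a0 a1 nu_gt1 nu_ltJ a_lower a_upper.
have nu_gt0 := ltnW nu_gt1.
have n2 : 2 <= nu%:R :> R by rewrite ler_nat.
have nx : nu%:R + 1 <= J%:R :> R by rewrite natr1 ler_nat.
have [b [g [[b0 b1 ab1 abJ] [gharm g1 gn d0]]]] :
    exists b g : R, [/\ 0 < b, b <= 1, 1 < a + b & a < (a - b) * J%:R]
    /\ [/\ g / J%:R + g / nu%:R = 1, 1 <= g, g <= nu%:R & 0 < g - 1 - a * g].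
  have x0 : 0 < J%:R :> R by rewrite ltr0n.
  have n0 : 0 < nu%:R :> R by rewrite ltr0n.
  apply: station_constants => //.
    by rewrite -ltr_pdivrMr //; lra.
  have den0 : 0 < nu%:R * J%:R ^+ 2 + J%:R + nu%:R :> R.
    by rewrite !addr_gt0 // mulr_gt0 // exprn_gt0.
  by rewrite -ltr_pdivrMr //; lra.
clear a_lower a_upper; have n0 : 0 <= nu%:R :> R by rewrite ler0n.
have g0 : 0 < g by exact: lt_le_trans g1.
pose C : R := (nu%:R + 3) / (g - 1 - a * g).
have C0 : 0 < C by rewrite divr_gt0 // ltr_wpDl.
have Cg0 : 0 < C * g by rewrite mulr_gt0.
pose CD : R := a + C * g + 1.
have CD0 : 0 < CD by rewrite !addr_gt0.
have ab0 : 0 < a - b.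
  by have := lt_trans a0 abJ; rewrite pmulr_lgt0 // ltr0n.
pose CP : R := (a - b + C * g + CD) * nu%:R + 1.
have CP0 : 0 < CP.
  by rewrite ltr_wpDl // mulr_ge0 // ltW // (addr_gt0 (addr_gt0 ab0 Cg0) CD0).
have gain0 : 0 < gain a b by apply: mulr_gt0; rewrite ?subr_gt0.
have gain1 : gain a b <= 1.
  rewrite /gain -[leRHS]mulr1; apply: ler_pM; rewrite ?(ltW a0) ?(ltW a1) ?subr_ge0 ?(ltW ab1) //.
  by rewrite lerBlDr; apply: lerD => //; exact: ltW.
have eta0 : 0 < gain a b / 4 by rewrite divr_gt0.
have eta1 : gain a b / 4 <= 1 by lra.
have loss0 : 0 <= loss nu g C.
  by rewrite /loss !addr_ge0 // mulr_ge0 ?(ltW C0) // addr_ge0 // ltW.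
pose w (al be ga de : R) : R :=
  (`|al| + `|be| + `|ga| + `|de| + 2 * CD) * (nu%:R + J%:R + 1).
have w0 al be ga de : 0 <= w al be ga de.
  by rewrite mulr_ge0 ?addr_ge0 // mulr_ge0 // ltW.
have [B B1 [B_1 B_2 B_3 B_4]] := common_bound (w0 a b 0 a)
  (w0 (a + C) (b - C * g) (- (C * g)) (a + C * g / J%:R))
  (w0 (a + C) (b - C * g) 0 a) (w0 a b (- CP) (a - CP / nu%:R)).
have [th th0 [thB thBB]] := small_step B1 eta0 eta1.
have thC0 : 0 < th * C by rewrite mulr_gt0.
have thCP0 : 0 < th * CP by rewrite mulr_gt0.
have quarter0 : (0 : R) < 4^-1 by rewrite invr_gt0.
have [K1 K10 HK1] := exp_decay thC0 (addr_ge0 loss0 ler01) quarter0.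
have lossCP : 0 <= loss nu g C + CP + 1.
  exact: addr_ge0 (addr_ge0 loss0 (ltW CP0)) ler01.
have [K K0 HK] := exp_decay thCP0 lossCP eta0.
have n30 : 0 <= 4 * (nu%:R + 3) / (th * C).
  by rewrite divr_ge0 ?(ltW thC0) // mulr_ge0 // addr_ge0.
(* [K2] makes the exponent in [K2_large] equal to [4 * (nu + 3)], and the shift [nu + J] in the last
   witness cancels the workload bound of an idle station. *)
exists th, CD, B, (gain a b / 4), b, g, C, CP, K1,
  (K1 + nu%:R + 4 * (nu%:R + 3) / (th * C)), (K + (nu%:R + J%:R)).
constructor; rewrite ?(ltW C0) ?(ltW eta0) ?lexx //.
- by rewrite /C divfK ?lexx // lt0r_neq0.
- by rewrite !addr_ge0.
- by rewrite !addr_ge0.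
- rewrite [X in expR X](_ : _ = 4 * (nu%:R + 3)); last by field; rewrite !gt_eqF.
  by apply: le_trans (expR_ge1Dx _); rewrite lerDr.
- by rewrite addrK.
Qed.

(** * Transience of every longest-queue service kernel, and the theorem *)

Lemma kernel_mean_seq (R : realType) (S : choiceType) (e : seq (R * S)) (f : S -> R) :
  \sum_(z <- undup [seq i.2 | i <- e]) (\sum_(i <- e) i.1 * (i.2 == z)%:R) * f z
  = \sum_(i <- e) i.1 * f i.2.
Proof.
under eq_bigr do rewrite mulr_suml.
rewrite exchange_big /= big_seq [RHS]big_seq; apply: eq_bigr => i ie.
rewrite (bigD1_seq i.2) ?undup_uniq ?mem_undup ?map_f //= eqxx mulr1 big1 ?addr0 //.
by move=> z /negPf zi; rewrite eq_sym zi mulr0 mul0r.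
Qed.

Lemma service_kernel_transient (R : realType) (J nu : nat) (a : R)
    (K : 'M[nat]_(2, J.+1) -> 'M[nat]_(2, J.+1) -> R) :
  0 < a -> a < 1 -> (1 < nu)%N -> (nu < J)%N ->
  J%:R / (2 * J%:R - 1) < a ->
  a < 1 - ((J%:R + 1) * (J%:R + nu%:R)) / (nu%:R * J%:R ^+ 2 + J%:R + nu%:R) ->
  service_kernel nu a K -> transient_chain K.
Proof.
move=> a0 a1 nu_gt1 nu_ltJ a_lower a_upper KS.
have J_gt0 : (0 < J)%N by exact: leq_ltn_trans nu_ltJ.
have [th [CD [B [eta [b [g [C [CP [K1 [K2 [K0 cst]]]]]]]]]]] :=
  drain_constants_exist J_gt0 a0 a1 nu_gt1 nu_ltJ a_lower a_upper.
pose h : 'M[nat]_(2, J.+1) -> R := @capped_potential R J nu a th CD b g C CP K1 K2 K0.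
have [l lP] := choice KS.
(* The joint law of schedule and arrivals as a finite weighted list. Different outcomes may lead to
   the same state, so the support [Z] is taken without repetition. *)
pose e q := [seq (i.1 * arrival_law a al, step q i.2 al)
            | i <- l q, al <- index_enum 'M[bool]_(2, J.+1)].
have sum_e (q : 'M[nat]_(2, J.+1)) (f : 'M[nat]_(2, J.+1) -> R) :
    \sum_(i <- e q) i.1 * f i.2
    = \sum_(i <- l q) i.1 * arrival_avg a (fun al => f (step q i.2 al)).
  rewrite big_allpairs_dep; apply: eq_bigr => i _; rewrite mulr_sumr.
  by apply: eq_bigr => al _ /=; rewrite mulrA.
have KE q q' : K q q' = \sum_(i <- e q) i.1 * (i.2 == q')%:R.
  have [_ _ _ ->] := lP q.
  by rewrite (sum_e q (fun z => (z == q')%:R)).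
have e_ge0 q i : i \in e q -> 0 <= i.1.
  have [l0 _ _ _] := lP q.
  by move=> /allpairsP[[p al] /= [pl _ ->]]; rewrite mulr_ge0 ?l0 ?arrival_law_ge0.
pose Z q := undup [seq i.2 | i <- e q].
have meanE (f : 'M[nat]_(2, J.+1) -> R) q : kernel_mean K Z f q
    = \sum_(i <- l q) i.1 * arrival_avg a (fun al => f (step q i.2 al)).
  rewrite -sum_e -kernel_mean_seq; apply: eq_bigr => z _.
  by rewrite KE.
apply: (@transient_criterion _ _ K Z _ _ _ _ h).
- by move=> q; exact: undup_uniq.
- by move=> q q'; rewrite KE big_seq sumr_ge0 // => i /e_ge0 i0; rewrite mulr_ge0.
- move=> q q' q'Z; rewrite KE big_seq big1 // => i ie.
  have [iq|_] := eqVneq i.2 q'; last by rewrite mulr0.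
  by move: q'Z; rewrite -iq mem_undup map_f.
- move=> q; have [_ l1 _ _] := lP q.
  transitivity (kernel_mean K Z (fun=> 1) q); first by apply: eq_bigr => z _; rewrite mulr1.
  by rewrite meanE -[RHS]l1; apply: eq_bigr => i _; rewrite arrival_avg_cst mulr1.
- by move=> q; exact/ltW/(capped_potential_gt0 cst).
- move=> q; have [l0 l1 lserv _] := lP q.
  rewrite meanE -[leRHS]mul1r -l1 mulr_suml big_seq [leRHS]big_seq ler_sum // => i il.
  have := l0 i il; rewrite le_eqVlt => /orP[/eqP <-|i0]; first by rewrite !mul0r.
  rewrite ler_pM2l //; have [ls _] := lserv i il i0.
  exact: (capped_potential_descent cst ls).
(* The path first empties the network, then builds an outer queue so long that the potential falls
   below its value at [q]. *)
- move=> q; have [x xP] := capped_potential_small cst ord0 (capped_potential_gt0 cst q).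
  have [n nx] : exists n : nat, x <= n%:R.
    exists (Num.bound `|x|).
    exact: le_trans (ler_norm x) (ltW (archi_boundP (normr_ge0 x))).
  have [q' [q0 q1 nq' rq']] := reach_outer nu_gt1 nu_ltJ a0 a1 KS ord0 n.
  have [p pK pq'] := reach_trans (reach_empty nu_gt1 nu_ltJ a0 a1 KS q) rq'.
  exists p => //; rewrite pq'; apply: xP => //.
  by rewrite (le_trans nx) // /outer ler_nat.
Qed.

Theorem theorem6 (R : realType) (J nu : nat) (a : R)
  (J_gt0 : (0 < J)%N) (nu_gt0 : (0 < nu)%N) (a_gt0 : 0 < a)
  (a_small : a * (1 + nu%:R^-1) < 1)
  (nu_gt1 : (1 < nu)%N) (nu_ltJ : (nu < J)%N)
  (a_lower : J%:R / (2 * J%:R - 1) < a)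
  (a_upper : a < 1 - ((J%:R + 1) * (J%:R + nu%:R))
                      / (nu%:R * J%:R ^+ 2 + J%:R + nu%:R)) :
  [/\ admissible nu (rho J a),
      forall kappa : 'M[nat]_(2, J.+1) -> 'M[nat]_(2, J.+1) -> R,
        max_weight_policy nu kappa ->
        transient_chain (switched_kernel nu a kappa),
      subcritical J nu a
    & forall kappa : 'M[nat]_(2, J.+1) -> {ffun 'I_2 -> 'I_J.+1} -> R,
        longest_queue_policy kappa ->
        transient_chain (lqfs_kernel nu a kappa)].
Proof.
have J0 : 0 < J%:R :> R by rewrite ltr0n.
have a_lt1 : a < 1.
  by apply: le_lt_trans a_small; rewrite ler_pMr // lerDl invr_ge0 ler0n.
(* The load of a station is [a * (1 + nu%:R^-1)]; this gives both the interior point and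
   subcriticality. *)
have load s : station_sum nu (rho J a s) < 1.
  rewrite /station_sum mxE eqxx.
  under eq_bigr => j j0 do rewrite mxE (negPf j0).
  rewrite sum_inner_cst [J%:R * _]mulrC divfK ?gt_eqF //.
  by apply: le_lt_trans a_small; rewrite mulrDr mulr1 [a * _]mulrC.
have transient := service_kernel_transient a_gt0 a_lt1 nu_gt1 nu_ltJ a_lower a_upper.
split.
- apply: (admissible_interior nu_gt0) => // s j; rewrite mxE.
  by case: ifP => _ //; rewrite divr_gt0.
- by move=> kappa pol; apply: transient; exact: switched_service_kernel.
- exact: load.
- by move=> kappa pol; apply: transient; exact: lqfs_service_kernel.
Qed.
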